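(* Let $(X_t)_{t\ge 0}$ be a one-dimensional Lévy process with parameters $(\bar b,\bar\nu_\sigma)\in\mathbb{R}\times\mathcal{M}(\mathbb{R})$, and let $P_{\bar b,\bar\nu_\sigma}$ denote the underlying probability when these are the true parameters. Let $\widehat\phi_n$ be the empirical characteristic function of the increments $X_t-X_{t-1}$, $t=1,\dots,n$. Let $d$ be a metric (on a set of functions $\mathbb{R}\to\mathbb{C}$ containing all $\phi(\cdot;\tilde b,\tilde\nu_\sigma)$, $\tilde b\in\mathbb{R}$, $\tilde\nu_\sigma\in\mathcal{M}(\mathbb{R})$, and all empirical characteristic functions) such that: (i) $\lim_{n\to\infty} d(\widehat\phi_n,\phi(\cdot;\bar b,\bar\nu_\sigma))=0$ holds $P_{\bar b,\bar\nu_\sigma}$-almost surely; (ii) for every sequence $(\bar b_n,\bar\nu_{\sigma,n})_{n}$ in $\mathbb{R}\times\mathcal{M}(\mathbb{R})$, if $\lim_{n\to\infty} d(\phi(\cdot;\bar b_n,\bar\nu_{\sigma,n}),\phi(\cdot;\bar b,\bar\nu_\sigma))=0$, then $\lim_{n\to\infty}\int_s^t\phi(u;\bar b_n,\bar\nu_{\sigma,n})\,du=\int_s^t\phi(u;\bar b,\bar\nu_\sigma)\,du$ for all $s,t\in\mathbb{R}$. Let $(\delta_n)_{n\in\mathbb{N}}$ be positive reals with $\delta_n\to 0$ and let the minimum distance fit $(\widehat{\bar b}_n,\widehat{\bar\nu}_{\sigma,n})\in\mathbb{R}\times\mathcal{M}(\mathbb{R})$ be chosen, for each $n$, such that $$d(\widehat\phi_n,\phi(\cdot;\widehat{\bar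 b}_n,\widehat{\bar\nu}_{\sigma,n}))\le\inf_{\tilde b\in\mathbb{R},\,\tilde\nu_\sigma\in\mathcal{M}(\mathbb{R})}d(\widehat\phi_n,\phi(\cdot;\tilde b,\tilde\nu_\sigma))+\delta_n .$$ Then $(\widehat{\bar b}_n,\widehat{\bar\nu}_{\sigma,n})$ is strongly consistent: with $P_{\bar b,\bar\nu_\sigma}$-probability one, as $n\to\infty$, $$\widehat{\bar b}_n\to\bar b\qquad\text{and}\qquad\widehat{\bar\nu}_{\sigma,n}\Longrightarrow\bar\nu_\sigma .$$
   Context: $\mathcal{M}(\mathbb{R})$ is the set of all finite (non-negative) Borel measures on $\mathbb{R}$, and $\Longrightarrow$ denotes weak convergence of finite Borel measures. A Lévy process with characteristic triplet $(\bar b,\sigma,\nu)$, where $\bar b\in\mathbb{R}$, $\sigma\ge 0$ and $\nu$ is a $\sigma$-finite measure with $\int\frac{x^2}{1+x^2}\nu(dx)<\infty$, has $E[e^{iuX_t}]=\exp(t\Psi(u))$ with $$\Psi(u)=iu\bar b-\tfrac{\sigma^2}{2}u^2+\int_{\mathbb{R}}\Big(e^{iux}-1-\tfrac{iux}{1+x^2}\Big)\nu(dx).$$ Put $\bar\nu_\sigma(dx)=\sigma^2\delta_0(dx)+\frac{x^2}{1+x^2}\nu(dx)$, a finite Borel measure ($\delta_0$ is the point mass at zero). Then $$\Psi(u)=\Psi(u;\bar b,\bar\nu_\sigma)=iu\bar b+\int_{\mathbb{R}}\frac{(e^{iux}-1)(1+x^2)-iux}{x^2}\,\bar\nu_\sigma(dx),$$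 where the integrand is extended continuously to $x=0$ by the value $-u^2/2$. The Lévy process is thus parametrised by $(\bar b,\bar\nu_\sigma)\in\mathbb{R}\times\mathcal{M}(\mathbb{R})$, and $\phi(u;\bar b,\bar\nu_\sigma)=\exp(\Psi(u;\bar b,\bar\nu_\sigma))$ is the characteristic function of $X_1$. The process is observed at times $0,1,\dots,n$, and the empirical characteristic function of the increments is $\widehat\phi_n(u)=\frac1n\sum_{t=1}^n e^{iu(X_t-X_{t-1})}$, $u\in\mathbb{R}$. *)

(* Defs.v *)
From HB Require Import structures.
From mathcomp Require Import all_boot all_order all_algebra.
From mathcomp Require Import complex.
From mathcomp Require Import all_classical all_reals all_analysis.

Set Implicit Arguments.
Unset Strict Implicit.
Unset Printing Implicit Defensive.

Import Order.TTheory GRing.Theory Num.Theory.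
Import numFieldNormedType.Exports.

Local Open Scope classical_set_scope.
Local Open Scope ring_scope.
Local Open Scope complex_scope.

Section complex_valued.
Context {R : realType}.
Implicit Types (f : R -> R[i]) (a s t : R).

Definition cis a : R[i] := cos a +i* sin a.

Definition cexp (z : R[i]) : R[i] := (expR (complex.Re z))%:C * cis (complex.Im z).

Definition cintegral {d : measure_display} {T : measurableType d}
    (mu : {measure set T -> \bar R}) (D : set T) (f : T -> R[i]) : R[i] :=
  (\int[mu]_(x in D) complex.Re (f x)) +i* (\int[mu]_(x in D) complex.Im (f x)).

(* Oriented: s and t may come in either order. *)
Definition cintegral_between s t f : R[i] :=
  if s <= t then cintegral lebesgue_measure `[s, t] f
  else - cintegral lebesgue_measure `[t, s] f.

End complex_valued.

Definition finite_borel_measure (R : realType) :=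
  {finite_measure set (measurableTypeR R) -> \bar R}.

Definition weak_cvg {R : realType} (mu_ : nat -> finite_borel_measure R)
    (mu : finite_borel_measure R) : Prop :=
  forall f : R -> R, continuous f -> [bounded f x | x in [set: R]] ->
    (\int[mu_ n]_x f x) @[n --> \oo] --> \int[mu]_x f x.

Section levy.
Context {R : realType}.
Implicit Types (b u x : R) (nu : finite_borel_measure R).

Definition levy_kernel u x : R[i] :=
  if x == 0 then (- (u ^+ 2 / 2))%:C
  else ((cis (u * x) - 1) * (1 + x ^+ 2)%:C - (u * x)*i) / (x ^+ 2)%:C.

(* [nu] is the measure sigma^2 delta_0(dx) + x^2 / (1 + x^2) nu'(dx), where
   sigma^2 is the Gaussian variance and nu' the Levy measure. *)
Definition levy_exponent b nu u : R[i] :=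
  (u * b)*i + cintegral nu [set: measurableTypeR R] (levy_kernel u).

Definition levy_cf b nu u : R[i] := cexp (levy_exponent b nu u).

End levy.

Section levy_process.
Context {R : realType} {d : measure_display} {Omega : measurableType d}.
Variable P : probability Omega R.
(* Only the variables [X t] with [0 <= t] are constrained or used. *)
Variable X : R -> {RV P >-> R}.

Definition increment (s t : R) (w : Omega) : R := X t w - X s w.

Definition independent_increments : Prop :=
  forall (n : nat) (t : nat -> R) (A : nat -> set R),
    0 <= t 0%N -> (forall k, (k < n)%N -> t k <= t k.+1) ->
    (forall k, (k < n)%N -> measurable (A k)) ->
    P (\bigcap_(k < n) (increment (t k) (t k.+1) @^-1` A k)) =
    (\prod_(k < n) P (increment (t k) (t k.+1) @^-1` A k))%E.

Definition stationary_increments : Prop :=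
  forall (s t h : R) (A : set R), 0 <= s -> 0 <= t -> 0 <= h -> measurable A ->
    P (increment s (s + h) @^-1` A) = P (increment t (t + h) @^-1` A).

Definition stochastically_continuous : Prop :=
  forall s eps : R, 0 <= s -> 0 < eps ->
    P [set w | eps < `|increment s t w|] @[t --> within `[0, +oo[ (nbhs s)]
      --> 0%E.

Definition levy_process : Prop :=
  [/\ {ae P, forall w, X 0 w = 0}, independent_increments,
      stationary_increments & stochastically_continuous].

Definition levy_process_with (b : R) (nu : finite_borel_measure R) : Prop :=
  levy_process /\
  forall t u : R, 0 <= t ->
    cintegral P [set: Omega] (fun w => cis (u * X t w)) =
    cexp (t%:C * levy_exponent b nu u).

(* Used for [0 < n]. *)
Definition empirical_cf (n : nat) (w : Omega) (u : R) : R[i] :=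
  n%:R^-1 * \sum_(k < n) cis (u * increment k%:R k.+1%:R w).

End levy_process.

(* [dist] is a metric on the subset [S] of [T]; outside [S] it is arbitrary. *)
Definition metric_on {R : realType} {T : Type} (S : set T)
    (dist : T -> T -> R) : Prop :=
  [/\ forall f g, S f -> S g -> 0 <= dist f g,
      forall f g, S f -> S g -> (dist f g = 0 <-> f = g),
      forall f g, S f -> S g -> dist f g = dist g f &
      forall f g h, S f -> S g -> S h -> dist f h <= dist f g + dist g h].

(* Main.v *)
Require Import Defs.
From HB Require Import structures.
From mathcomp Require Import all_boot all_order all_algebra.
From mathcomp Require Import complex ring lra.
From mathcomp Require Import all_classical all_reals all_analysis.
From mathcomp Require Import measurable_realfun.

Set Implicit Arguments.
Unset Strict Implicit.
Unset Printing Implicit Defensive.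

Import Order.TTheory GRing.Theory Num.Theory.
Import numFieldNormedType.Exports.

Local Open Scope classical_set_scope.
Local Open Scope ring_scope.

(** The fit is a near-minimiser, so by the triangle inequality its distance to
    the true characteristic function [phi] is at most twice the distance from the
    empirical one to [phi], plus [delta n]; almost surely this tends to [0].
    The rest is deterministic ([levy_parameters_cvg]): if the characteristic
    functions [phi_n] with parameters [(b_n, nu_n)] converge to [phi] in the
    sense of integrals over compact intervals, then [b_n] tends to [b] and [nu_n]
    converges weakly to [nu].

    Write [phi_n = exp (- g_n + i theta_n)], where [g_n >= 0] is the [damping] and
    [theta_n] the [phase].  Everything is read off the exponent, with no recourse
    to the probability measures behind the [phi_n].

    - Small frequencies.  The inequality [g u <= 2 g w + 2 g (u + w)] bounds
      [1 - exp (- g u)] pointwise by its average near [0], and this average is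
      controlled by the integral of the real part of [phi_n].  Hence [g_n] is
      uniformly small near [0] ([damping_small]).  Averaging [g_n] there gives
      uniform bounds on the tails and on the masses of the [nu_n]
      ([tail_mass_le], [mass_le]).
    - Pointwise convergence.  The defect [Psi (u + w) - Psi u - Psi w] of the
      exponent [Psi] is small when [g w] is, so [phi_n (u + w)] is close to
      [phi_n u * phi_n w] for small [w].  Averaging over such [w] expresses
      [phi_n u] through two integrals of [phi_n], and [phi_n u] tends to [phi u]
      ([cf_cvg]).
    - Logarithm without branches.  Pointwise convergence determines [theta_n u]
      only modulo [2 pi].  But the second difference
      [Psi (u + w) + Psi (u - w) - 2 Psi u] has modulus at most [2 g w], hence is
      smaller than [pi] for small [w], and it converges
      ([jump_phase_second_diff_cvg]).  In it the drift and the compensator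
      disappear: it is, up to the factor [- 2], the Fourier transform at [u] of
      [k_w dnu_n], where [k_w x = (1 - cos (w x)) (1 + x ^ 2) / x ^ 2].
    - Weak convergence.  Tightness and convergence of the Fourier transforms give
      convergence of the integrals of bounded continuous functions against
      [k_w dnu_n] ([levy_continuity], by trigonometric approximation), and [k_w]
      is positive on an interval as large as desired when [w] is small
      ([weak_cvg_of_weighted]).
    - Drift.  Weak convergence takes care of the integral part of [theta_n], so
      [u (b_n - b)] tends to [0] modulo [2 pi] for all [u]; this forces
      [b_n - b] to tend to [0] ([phase_null_drift]). *)

(** * Trigonometric inequalities *)

Section trigonometric_bounds.
Context {R : realType}.
Implicit Types x y a b eta : R.

Lemma sin_mvt y : exists2 c, `|c| <= `|y| & sin y = cos c * y.
Proof.
wlog y0 : y / 0 <= y => [hwlog|].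
  have [/hwlog//|/ltW y0] := leP 0 y.
  have [|c cy e] := hwlog (- y); first by rewrite oppr_ge0.
  exists c; first by rewrite normrN in cy.
  by apply: oppr_inj; rewrite -sinN e mulrN.
have cs : {within `[0, y], continuous sin}.
  by apply: continuous_subspaceT => x; exact: continuous_sin.
have [c /itvP cy] := MVT_segment y0 (fun x _ => is_derive_sin x) cs.
rewrite sin0 !subr0 => e; exists c => //.
by rewrite !ger0_norm // cy.
Qed.

Lemma ler_norm_sin y : `|sin y| <= `|y|.
Proof.
have [c _ ->] := sin_mvt y.
by rewrite normrM ler_piMl // cos_max.
Qed.

Lemma one_sub_cosE y : 1 - cos y = 2 * sin (y / 2) ^+ 2.
Proof.
have {1}-> : y = (y / 2) *+ 2 by rewrite mulr2n -splitr.
by rewrite cos_mulr2n; have := cos2Dsin2 (y / 2); lra.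
Qed.

Lemma one_sub_cos_le y : 1 - cos y <= y ^+ 2 / 2.
Proof.
rewrite one_sub_cosE.
have : sin (y / 2) ^+ 2 <= (y / 2) ^+ 2.
  by rewrite -real_normK ?num_real // -[leRHS]real_normK ?num_real // lerXn2r
    ?nnegrE ?normr_ge0 ?ler_norm_sin.
by move: (sin (y / 2)) => s; nra.
Qed.

Lemma one_sub_cos_ge0 y : 0 <= 1 - cos y.
Proof. by rewrite subr_ge0 cos_le1. Qed.

Lemma sin_sub_le y : `|sin y - y| <= `|y| * (y ^+ 2 / 2).
Proof.
have [c cy ->] := sin_mvt y.
rewrite -{2}[y]mul1r -mulrBl normrM mulrC ler_wpM2l //.
rewrite distrC ger0_norm ?one_sub_cos_ge0 //.
apply: le_trans (one_sub_cos_le c) _.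
by rewrite ler_wpM2r ?invr_ge0 // -(real_normK (num_real c))
  -(real_normK (num_real y)) lerXn2r ?nnegrE ?normr_ge0.
Qed.

Lemma sin_sub_le2 y : `|sin y - y| <= y ^+ 2 / 2 * 2.
Proof.
have [y1|y1] := leP (`|y|) 2.
  apply: le_trans (sin_sub_le y) _; rewrite mulrC ler_wpM2l //.
  by rewrite divr_ge0 // sqr_ge0.
apply: le_trans (ler_normB _ _) _; have := ler_norm_sin y.
rewrite -(real_normK (num_real y)); move: (`|y|) y1 (`|sin y|) => u *; nra.
Qed.

(** Since [1 - cos] vanishes at [2 pi] the bound must be local; the range
    [|y| <= 2] is that of a difference of two numbers of modulus at most [1]. *)
Lemma one_sub_cos_ge y : `|y| <= 2 -> y ^+ 2 / 8 <= 1 - cos y.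
Proof.
move=> y2; rewrite one_sub_cosE.
set z := y / 2; have yz : y = 2 * z by rewrite /z mulrC divfK.
have z1 : `|z| <= 1 by move: y2; rewrite yz normrM (gtr0_norm (ltr0n R 2)); lra.
have /= := sin_sub_le z; set s := sin z => sz.
have : `|z| / 2 <= `|s|.
  have := lerB_dist s z; have := ler_normB s (s - z).
  rewrite [s - (s - z)]subKr.
  have : `|z| * (z ^+ 2 / 2) <= `|z| / 2.
    rewrite -(real_normK (num_real z)); move: (normr_ge0 z) z1.
    by move: `|z| => w; nra.
  lra.
move=> h; have : (`|z| / 2) ^+ 2 <= `|s| ^+ 2.
  by rewrite lerXn2r ?nnegrE ?divr_ge0 ?normr_ge0.
by rewrite expr_div_n !real_normK ?num_real // yz; lra.
Qed.

Lemma sqr_half_sub_cos y : `|1 - cos y - y ^+ 2 / 2| <= y ^+ 4 / 8.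
Proof.
rewrite one_sub_cosE; set z := y / 2.
have -> : y = 2 * z by rewrite /z mulrC divfK.
have -> : 2 * sin z ^+ 2 - (2 * z) ^+ 2 / 2 = 2 * ((sin z - z) * (sin z + z)).
  by field.
have h1 := sin_sub_le z.
have h2 : `|sin z + z| <= 2 * `|z|.
  by apply: le_trans (ler_normD _ _) _; have := ler_norm_sin z; lra.
rewrite normrM (gtr0_norm (ltr0n R 2)) normrM.
have -> : (2 * z) ^+ 4 / 8 = 2 * ((`|z| * (z ^+ 2 / 2)) * (2 * `|z|)).
  have -> : (`|z| * (z ^+ 2 / 2)) * (2 * `|z|) = `|z| ^+ 2 * z ^+ 2 by field.
  by rewrite real_normK ?num_real //; field.
by rewrite ler_wpM2l // ler_pM.
Qed.

(** The triangle inequality for [sqrt (1 - cos)], a multiple of the chordal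
    distance to [1] on the unit circle, up to a factor [2]. *)
Lemma one_sub_cos_chord a b :
  1 - cos a <= 2 * (1 - cos b) + 2 * (1 - cos (a + b)).
Proof.
have -> : a = (a + b) - b by lra.
move: (a + b) => c; rewrite subrK cosB.
have := cos2Dsin2 b; have := cos2Dsin2 c.
move: (cos b) (sin b) (cos c) (sin c) => cb sb cd sd.
have : 0 <= (cb + cd - 2) ^+ 2 + (sb + sd) ^+ 2 by rewrite addr_ge0 // sqr_ge0.
rewrite !expr2; nra.
Qed.

(** Weighted arithmetic-geometric mean, in the form that lets the first factor
    be merely bounded while the second tends to [0]. *)
Lemma weighted_amgm eta x y : 0 < eta ->
  `|x * y| <= (eta * x ^+ 2 + y ^+ 2 / eta) / 2.
Proof.
move=> e0; have h : 0 <= (eta * x ^+ 2 + y ^+ 2 / eta) / 2 - x * y.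
  have -> : (eta * x ^+ 2 + y ^+ 2 / eta) / 2 - x * y =
    (eta * x - y) ^+ 2 / eta / 2 by field; rewrite gt_eqF.
  by rewrite !divr_ge0 ?sqr_ge0 // ltW.
have k : 0 <= (eta * x ^+ 2 + y ^+ 2 / eta) / 2 + x * y.
  have -> : (eta * x ^+ 2 + y ^+ 2 / eta) / 2 + x * y =
    (eta * x + y) ^+ 2 / eta / 2 by field; rewrite gt_eqF.
  by rewrite !divr_ge0 ?sqr_ge0 // ltW.
by rewrite ler_norml; lra.
Qed.

Lemma sqr_one_sub_cos a : (1 - cos a) ^+ 2 <= 2 * (1 - cos a).
Proof. by have := cos_le1 a; have := cos_geN1 a; nra. Qed.

Lemma sqr_sin_le a : sin a ^+ 2 <= 2 * (1 - cos a).
Proof. by rewrite sin2cos2; have := cos_le1 a; have := cos_geN1 a; nra. Qed.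

Lemma weighted_amgm_circle eta a b x y : 0 < eta ->
  x ^+ 2 <= 2 * (1 - cos a) -> y ^+ 2 <= 2 * (1 - cos b) ->
  `|x * y| <= eta * (1 - cos a) + (1 - cos b) / eta.
Proof.
move=> e0 xa yb; apply: le_trans (weighted_amgm x y e0) _.
have : eta * x ^+ 2 <= eta * (2 * (1 - cos a)) by rewrite ler_wpM2l // ltW.
have : y ^+ 2 / eta <= 2 * (1 - cos b) / eta by rewrite ler_wpM2r // invr_ge0 ltW.
rewrite -mulrA [eta * (2 * _)]mulrCA; lra.
Qed.

(** Up to sign, the real part of [(e^{ia} - 1) (e^{ib} - 1)]; each factor has
    squared modulus [2 (1 - cos)], which is the source of the right-hand side. *)
Lemma cos_defect eta a b : 0 < eta ->
  `|(1 - cos (a + b)) - (1 - cos a) - (1 - cos b)| <=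
  2 * (eta * (1 - cos a) + (1 - cos b) / eta).
Proof.
move=> e0; rewrite cosD.
have -> : (1 - (cos a * cos b - sin a * sin b)) - (1 - cos a) - (1 - cos b) =
  sin a * sin b - (1 - cos a) * (1 - cos b) by ring.
apply: le_trans (ler_normB _ _) _; rewrite [leRHS]mulr_natl mulr2n.
by apply: lerD; apply: weighted_amgm_circle; rewrite ?sqr_sin_le ?sqr_one_sub_cos.
Qed.

Lemma sin_defect eta a b : 0 < eta ->
  `|sin (a + b) - sin a - sin b| <=
  2 * (eta * (1 - cos a) + (1 - cos b) / eta).
Proof.
move=> e0; rewrite sinD.
have -> : sin a * cos b + cos a * sin b - sin a - sin b =
  - (sin a * (1 - cos b)) - (1 - cos a) * sin b by ring.
apply: le_trans (ler_normB _ _) _; rewrite normrN [leRHS]mulr_natl mulr2n.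
by apply: lerD; apply: weighted_amgm_circle; rewrite ?sqr_sin_le ?sqr_one_sub_cos.
Qed.

End trigonometric_bounds.

(** * The Levy-Khintchine kernel *)

Section kernel.
Context {R : realType}.
Implicit Types x y u w eta : R.

(** [cosq] and [sinq] are continuous and bounded on the whole line.  For [sinq]
    the value [0] at [0] is provided by division by zero. *)
Definition cosq y : R := if y == 0 then 2^-1 else (1 - cos y) / y ^+ 2.
Definition sinq y : R := (sin y - y) / y ^+ 2.

Lemma cosq_ge0 y : 0 <= cosq y.
Proof.
by rewrite /cosq; case: ifP => _;
  rewrite ?invr_ge0 // divr_ge0 ?sqr_ge0 ?one_sub_cos_ge0.
Qed.

Lemma cosq_le y : cosq y <= 2^-1.
Proof.
rewrite /cosq; case: ifPn => // y0.
by rewrite ler_pdivrMr ?exprn_even_gt0 // mulrC one_sub_cos_le.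
Qed.

Lemma sinq_le y : `|sinq y| <= 1.
Proof.
have [->|y0] := eqVneq y 0; first by rewrite /sinq subr0 sin0 mul0r normr0.
rewrite /sinq normrM normfV ler_pdivrMr ?normr_gt0 ?expf_neq0 //.
rewrite (ger0_norm (sqr_ge0 _)) mul1r.
by apply: le_trans (sin_sub_le2 y) _; rewrite divfK.
Qed.

Lemma continuous_at_neq0 (f g : R -> R) : (forall y, y != 0 -> f y = g y) ->
  forall y, y != 0 -> {for y, continuous g} -> {for y, continuous f}.
Proof.
move=> fg y y0 cg; rewrite /prop_for /continuous_at fg //.
apply: cvg_trans cg; apply: near_eq_cvg; near=> z; apply/esym/fg.
by near: z; apply: (@cvgr_neq0 _ _ _ _ _ id y) => //; exact: cvg_id.
Unshelve. all: by end_near. Qed.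

Lemma continuous_at0_lipschitz (f : R -> R) :
  (forall y, `|f y - f 0| <= `|y|) -> {for 0, continuous f}.
Proof.
move=> h; apply/cvgrPdist_le => e e0; near=> y.
rewrite distrC; apply: le_trans (h y) _.
rewrite -[y]subr0 distrC; near: y.
by apply: (@cvgr_dist_le _ _ _ _ _ id) => //; exact: cvg_id.
Unshelve. all: by end_near. Qed.

Lemma continuous_cosq : continuous (cosq : R -> R).
Proof.
move=> y; have [->|y0] := eqVneq y 0; last first.
  apply: (@continuous_at_neq0 _ (fun z => (1 - cos z) / z ^+ 2)) => //.
    by move=> z z0; rewrite /cosq (negPf z0).
  apply: continuousM.
    by apply: continuousB; [exact: cst_continuous|exact: continuous_cos].
  apply: continuousV; first by rewrite expf_neq0.
  exact: exprn_continuous.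
apply: continuous_at0_lipschitz => z; rewrite {2}/cosq eqxx /cosq.
case: ifPn => [_|z0]; first by rewrite subrr normr0.
have -> : (1 - cos z) / z ^+ 2 - 2^-1 = (1 - cos z - z ^+ 2 / 2) / z ^+ 2 by field.
have [z8|z8] := leP `|z| 1.
  rewrite normrM normfV (ger0_norm (sqr_ge0 _)) ler_pdivrMr ?exprn_even_gt0 //.
  apply: le_trans (sqr_half_sub_cos z) _.
  have -> : z ^+ 4 / 8 = `|z| ^+ 2 * z ^+ 2 / 8.
    by rewrite real_normK ?num_real //; field.
  have -> : `|z| ^+ 2 * z ^+ 2 / 8 = (`|z| ^+ 2 / 8) * z ^+ 2 by ring.
  rewrite ler_wpM2r ?sqr_ge0 //.
  by move: (normr_ge0 z) z8; move: `|z| => a; nra.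
have := cosq_ge0 z; have := cosq_le z; rewrite /cosq (negPf z0) => h1 h2.
have -> : (1 - cos z - z ^+ 2 / 2) / z ^+ 2 = (1 - cos z) / z ^+ 2 - 2^-1 by field.
by rewrite ler_norml; lra.
Qed.

Lemma continuous_sinq : continuous (sinq : R -> R).
Proof.
move=> y; have [->|y0] := eqVneq y 0; last first.
  apply: (@continuous_at_neq0 _ (fun z => (sin z - z) / z ^+ 2)) => //.
  apply: continuousM.
    by apply: continuousB; [exact: continuous_sin|exact: cvg_id].
  apply: continuousV; first by rewrite expf_neq0.
  exact: exprn_continuous.
apply: continuous_at0_lipschitz => z; rewrite {2}/sinq sin0 !subrr mul0r subr0.
have [->|z0] := eqVneq z 0; first by rewrite /sinq sin0 subrr mul0r normr0.
rewrite /sinq normrM normfV (ger0_norm (sqr_ge0 _)) ler_pdivrMr ?exprn_even_gt0 //.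
apply: le_trans (sin_sub_le z) _; rewrite ler_wpM2l //.
by have := sqr_ge0 z; lra.
Qed.

(** Minus the real part and the imaginary part of [levy_kernel u x]
    ([levy_kernelE]), arranged so that regularity in both variables, in
    particular at [x = 0], is inherited from [cosq] and [sinq]. *)
Definition damp_kernel u x : R := (1 - cos (u * x)) + u ^+ 2 * cosq (u * x).
Definition phase_kernel u x : R := sin (u * x) + u ^+ 2 * sinq (u * x).

Lemma damp_kernel0 u : damp_kernel u 0 = u ^+ 2 / 2.
Proof. by rewrite /damp_kernel mulr0 cos0 subrr add0r /cosq eqxx. Qed.

Lemma phase_kernel0 u : phase_kernel u 0 = 0.
Proof. by rewrite /phase_kernel mulr0 /sinq sin0 subrr mul0r mulr0 addr0. Qed.

Lemma damp_kernelE u x : x != 0 ->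
  damp_kernel u x = (1 - cos (u * x)) * ((1 + x ^+ 2) / x ^+ 2).
Proof.
move=> x0; rewrite /damp_kernel /cosq mulf_eq0 (negPf x0) orbF.
case: ifPn => [/eqP->|u0]; first by rewrite mul0r cos0 subrr expr0n /= !mul0r addr0.
by field; rewrite x0 u0.
Qed.

Lemma phase_kernelE u x : x != 0 ->
  phase_kernel u x = sin (u * x) * ((1 + x ^+ 2) / x ^+ 2) - u / x.
Proof.
move=> x0; rewrite /phase_kernel /sinq; have [->|u0] := eqVneq u 0.
  by rewrite !mul0r sin0 expr0n /= !mul0r addr0 subr0.
by field; rewrite x0 u0.
Qed.

Lemma weight_ge1 x : x != 0 -> 1 <= (1 + x ^+ 2) / x ^+ 2.
Proof.
by move=> x0; rewrite ler_pdivlMr ?exprn_even_gt0 // mul1r lerDr.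
Qed.

Lemma one_sub_cos_le_damp_kernel u x : 1 - cos (u * x) <= damp_kernel u x.
Proof. by rewrite lerDl mulr_ge0 ?sqr_ge0 ?cosq_ge0. Qed.

Lemma damp_kernel_ge0 u x : 0 <= damp_kernel u x.
Proof. by apply: le_trans (one_sub_cos_le_damp_kernel u x); exact: one_sub_cos_ge0. Qed.

Lemma damp_kernel_le u x : damp_kernel u x <= 2 + u ^+ 2 / 2.
Proof.
by apply: lerD; [have := cos_geN1 (u * x); lra|rewrite ler_wpM2l ?sqr_ge0 ?cosq_le].
Qed.

Lemma phase_kernel_le u x : `|phase_kernel u x| <= 1 + u ^+ 2.
Proof.
apply: le_trans (ler_normD _ _) _; apply: lerD; first exact: sin_max.
rewrite normrM (ger0_norm (sqr_ge0 _)) -[leRHS]mulr1.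
by rewrite ler_wpM2l ?sqr_ge0 ?sinq_le.
Qed.

Lemma damp_kernel_lower u x : `|u * x| <= 2 -> u ^+ 2 / 8 <= damp_kernel u x.
Proof.
move=> ux; have [->|x0] := eqVneq x 0.
  by rewrite damp_kernel0; have := sqr_ge0 u; lra.
rewrite damp_kernelE // mulrA ler_pdivlMr ?exprn_even_gt0 //.
have := one_sub_cos_ge ux; have := one_sub_cos_ge0 (u * x).
rewrite exprMn; have := sqr_ge0 x; nra.
Qed.

Lemma damp_kernel_chord u w x :
  damp_kernel u x <= 2 * damp_kernel w x + 2 * damp_kernel (u + w) x.
Proof.
have [->|x0] := eqVneq x 0; first by
  rewrite !damp_kernel0 !expr2; have := sqr_ge0 (2 * w + u); rewrite expr2; nra.
rewrite !damp_kernelE // [(u + w) * x]mulrDl; have := weight_ge1 x0; set m := (_ / _) => m1.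
have m0 : 0 <= m by apply: le_trans m1.
by have := ler_wpM2r m0 (one_sub_cos_chord (u * x) (w * x)); lra.
Qed.

(** The exponent is nearly additive at [u] and [w] when [damp_kernel w] is small:
    here and in [phase_kernel_defect] the parameter [eta] is to be chosen small
    first, and the size of [w] afterwards. *)
Lemma damp_kernel_defect eta u w x : 0 < eta ->
  `|damp_kernel (u + w) x - damp_kernel u x - damp_kernel w x| <=
  2 * (eta * damp_kernel u x + damp_kernel w x / eta).
Proof.
move=> e0; have [->|x0] := eqVneq x 0.
  rewrite !damp_kernel0; have -> : (u + w) ^+ 2 / 2 - u ^+ 2 / 2
    - w ^+ 2 / 2 = u * w by field.
  apply: le_trans (weighted_amgm u w e0) _.
  have : 0 <= eta * u ^+ 2 by rewrite mulr_ge0 ?sqr_ge0 ?ltW.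
  have : 0 <= w ^+ 2 / eta by rewrite divr_ge0 ?sqr_ge0 ?ltW.
  rewrite -[w ^+ 2 / 2 / eta]mulrA [2^-1 / eta]mulrC !mulrA; lra.
rewrite !damp_kernelE //; have := weight_ge1 x0; set m := (_ / _) => m1.
have m0 : 0 <= m by apply: le_trans m1.
rewrite -!mulrBl normrM (ger0_norm m0) [(u + w) * x]mulrDl.
apply: le_trans (ler_wpM2r m0 (cos_defect _ _ e0)) _.
by rewrite le_eqVlt; apply/orP; left; apply/eqP; ring.
Qed.

Lemma phase_kernel_defect eta u w x : 0 < eta ->
  `|phase_kernel (u + w) x - phase_kernel u x - phase_kernel w x| <=
  2 * (eta * damp_kernel u x + damp_kernel w x / eta).
Proof.
move=> e0; have [->|x0] := eqVneq x 0.
  rewrite !phase_kernel0 !subr0 normr0.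
  by rewrite mulr_ge0 // addr_ge0 ?mulr_ge0 ?invr_ge0 ?damp_kernel_ge0 // ltW.
rewrite !phase_kernelE // !damp_kernelE //; have := weight_ge1 x0; set m := (_ / _) => m1.
have m0 : 0 <= m by apply: le_trans m1.
have -> : sin ((u + w) * x) * m - (u + w) / x - (sin (u * x) * m - u / x) -
   (sin (w * x) * m - w / x) =
  (sin (u * x + w * x) - sin (u * x) - sin (w * x)) * m by rewrite [(u + w) * x]mulrDl;
    ring.
rewrite normrM (ger0_norm m0).
apply: le_trans (ler_wpM2r m0 (sin_defect _ _ e0)) _.
by rewrite le_eqVlt; apply/orP; left; apply/eqP; ring.
Qed.

(** The drift and the compensator are linear in [u], so they drop out of second
    differences, which leave the integrand of a Fourier transform with weight
    [damp_kernel w]. *)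
Lemma damp_kernel_second_diff u w x :
  damp_kernel (u + w) x + damp_kernel (u - w) x - 2 * damp_kernel u x =
  2 * (cos (u * x) * damp_kernel w x).
Proof.
have [->|x0] := eqVneq x 0; first by rewrite !damp_kernel0 mulr0 cos0; field.
rewrite !damp_kernelE // [(u + w) * x]mulrDl [(u - w) * x]mulrBl cosD cosB; ring.
Qed.

Lemma phase_kernel_second_diff u w x :
  phase_kernel (u + w) x + phase_kernel (u - w) x - 2 * phase_kernel u x =
  - 2 * (sin (u * x) * damp_kernel w x).
Proof.
have [->|x0] := eqVneq x 0; first by rewrite !phase_kernel0 !mulr0 sin0; ring.
rewrite !phase_kernelE // damp_kernelE //
  [(u + w) * x]mulrDl [(u - w) * x]mulrBl sinD sinB; ring.
Qed.

Lemma continuous_mull u : continuous (fun x : R => u * x).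
Proof. by move=> x; apply: continuousM; [exact: cst_continuous|exact: cvg_id]. Qed.

Lemma continuous_damp_kernel u : continuous (damp_kernel u).
Proof.
change (continuous (fun x : R => (1 - cos (u * x)) + u ^+ 2 * cosq (u * x))).
move=> x; apply: cvgD.
  apply: cvgB; first exact: cst_continuous.
  by apply: (@continuous_comp _ _ _ (fun x => u * x) cos);
    [exact: continuous_mull|exact: continuous_cos].
apply: cvgM; first exact: cst_continuous.
by apply: (@continuous_comp _ _ _ (fun x => u * x) cosq);
    [exact: continuous_mull|exact: continuous_cosq].
Qed.

Lemma continuous_phase_kernel u : continuous (phase_kernel u).
Proof.
change (continuous (fun x : R => sin (u * x) + u ^+ 2 * sinq (u * x))).
move=> x; apply: cvgD.
  by apply: (@continuous_comp _ _ _ (fun x => u * x) sin);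
    [exact: continuous_mull|exact: continuous_sin].
apply: cvgM; first exact: cst_continuous.
by apply: (@continuous_comp _ _ _ (fun x => u * x) sinq);
    [exact: continuous_mull|exact: continuous_sinq].
Qed.

Lemma continuous_mulr x : continuous (fun u : R => u * x).
Proof. by move=> u; apply: cvgM; [exact: cvg_id|exact: cst_continuous]. Qed.

Lemma continuous_damp_kernel1 x : continuous (damp_kernel ^~ x).
Proof.
change (continuous (fun u : R => (1 - cos (u * x)) + u ^+ 2 * cosq (u * x))).
move=> u; apply: cvgD.
  apply: cvgB; first exact: cst_continuous.
  by apply: (@continuous_comp _ _ _ (fun u => u * x) cos);
    [exact: continuous_mulr|exact: continuous_cos].
apply: cvgM; first exact: exprn_continuous.
by apply: (@continuous_comp _ _ _ (fun u => u * x) cosq);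
    [exact: continuous_mulr|exact: continuous_cosq].
Qed.

Lemma continuous_phase_kernel1 x : continuous (phase_kernel ^~ x).
Proof.
change (continuous (fun u : R => sin (u * x) + u ^+ 2 * sinq (u * x))).
move=> u; apply: cvgD.
  by apply: (@continuous_comp _ _ _ (fun u => u * x) sin);
    [exact: continuous_mulr|exact: continuous_sin].
apply: cvgM; first exact: exprn_continuous.
by apply: (@continuous_comp _ _ _ (fun u => u * x) sinq);
    [exact: continuous_mulr|exact: continuous_sinq].
Qed.

Lemma levy_kernelE u x :
  levy_kernel u x = (- damp_kernel u x +i* phase_kernel u x)%C.
Proof.
rewrite /levy_kernel; have [->|x0] := eqVneq x 0;
  first by rewrite damp_kernel0 phase_kernel0.
rewrite damp_kernelE // phase_kernelE //.
have -> : ((x ^+ 2)%:C^-1)%C = ((x ^+ 2)^-1)%:C%C :> R[i] by rewrite fmorphV.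
apply/eqP; rewrite eq_complex /=; simpc => /=.
apply/andP; split; apply/eqP.
  by field.
by field.
Qed.

End kernel.

(** * Finite measures integrated against bounded continuous functions *)

Section bounded_continuous.
Context {R : realType}.
Implicit Types (f g : R -> R) (nu : finite_borel_measure R) (u x c M : R).

Definition bounded_continuous f :=
  continuous f /\ exists M, forall x, `|f x| <= M.

Lemma bc_of_bounded f : continuous f -> [bounded f x | x in [set: R]] ->
  bounded_continuous f.
Proof.
move=> cf [M [_ h]]; split=> //; exists (M + 1) => x.
by apply: h => //; rewrite ltrDl.
Qed.

Lemma bc_bounded f : bounded_continuous f -> [bounded f x | x in [set: R]].
Proof.
move=> [_ [M h]]; exists M; split; first exact: num_real.
by move=> N MN x _; apply: le_trans (h x) (ltW MN).
Qed.

Lemma bc_cst c : bounded_continuous (fun=> c).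
Proof. by split; [exact: cst_continuous|exists `|c|]. Qed.

Lemma bcD f g : bounded_continuous f -> bounded_continuous g ->
  bounded_continuous (fun x => f x + g x).
Proof.
move=> [cf [M fM]] [cg [N gN]]; split.
  by move=> x; apply: cvgD; [exact: cf|exact: cg].
by exists (M + N) => x; apply: le_trans (ler_normD _ _) (lerD (fM x) (gN x)).
Qed.

Lemma bcM f g : bounded_continuous f -> bounded_continuous g ->
  bounded_continuous (fun x => f x * g x).
Proof.
move=> [cf [M fM]] [cg [N gN]]; split.
  by move=> x; apply: cvgM; [exact: cf|exact: cg].
by exists (M * N) => x; rewrite normrM ler_pM.
Qed.

Lemma bcZ c f : bounded_continuous f -> bounded_continuous (fun x => c * f x).
Proof. by apply: bcM; exact: bc_cst. Qed.

Lemma bcB f g : bounded_continuous f -> bounded_continuous g ->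
  bounded_continuous (fun x => f x - g x).
Proof.
move=> bf bg; have := bcD bf (bcZ (-1) bg).
by under [X in bounded_continuous X]eq_fun do rewrite mulN1r.
Qed.

Lemma bc_cos u : bounded_continuous (fun x => cos (u * x)).
Proof.
split; last by exists 1 => x; exact: cos_max.
by move=> x; apply: (@continuous_comp _ _ _ (fun x => u * x) cos);
  [exact: continuous_mull|exact: continuous_cos].
Qed.

Lemma bc_sin u : bounded_continuous (fun x => sin (u * x)).
Proof.
split; last by exists 1 => x; exact: sin_max.
by move=> x; apply: (@continuous_comp _ _ _ (fun x => u * x) sin);
  [exact: continuous_mull|exact: continuous_sin].
Qed.

Lemma bc_damp_kernel u : bounded_continuous (damp_kernel u).
Proof.
split; first exact: continuous_damp_kernel.
by exists (2 + u ^+ 2 / 2) => x; rewrite ger0_norm ?damp_kernel_ge0 ?damp_kernel_le.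
Qed.

Lemma bc_phase_kernel u : bounded_continuous (phase_kernel u).
Proof.
by split; [exact: continuous_phase_kernel|exists (1 + u ^+ 2) => x; exact: phase_kernel_le].
Qed.

Lemma bc_measurable f (D : set (measurableTypeR R)) : bounded_continuous f ->
  measurable_fun D (f : measurableTypeR R -> R).
Proof.
by move=> [cf _]; apply: measurable_funTS; exact: continuous_measurable_fun.
Qed.

Lemma bc_integrable nu f : bounded_continuous f ->
  nu.-integrable [set: measurableTypeR R] (EFin \o f).
Proof.
move=> bf; apply: measurable_bounded_integrable => //.
- by rewrite -ge0_fin_numE // fin_num_measure.
- exact: bc_measurable.
- exact: bc_bounded.
Qed.

Definition mass nu : R := fine (nu setT).

Definition tail_mass nu (K : R) : R := fine (nu [set x : R | K < `|x|]).

Lemma measurable_norm_gt (K : R) :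
  measurable ([set x : R | K < `|x|] : set (measurableTypeR R)).
Proof.
have := @normr_measurable R setT measurableT `]K, +oo[%classic (measurable_itv _).
by rewrite setTI; congr measurable; apply/seteqP; split=> x /=;
  rewrite in_itv /= andbT.
Qed.

Lemma mass_ge0 nu : 0 <= mass nu.
Proof. exact/fine_ge0/measure_ge0. Qed.

Lemma tail_mass_ge0 nu K : 0 <= tail_mass nu K.
Proof. exact/fine_ge0/measure_ge0. Qed.

Lemma bc_RintegralD nu f g : bounded_continuous f -> bounded_continuous g ->
  \int[nu]_x (f x + g x) = \int[nu]_x f x + \int[nu]_x g x.
Proof. by move=> bf bg; rewrite RintegralD //; exact: bc_integrable. Qed.

Lemma bc_RintegralB nu f g : bounded_continuous f -> bounded_continuous g ->
  \int[nu]_x (f x - g x) = \int[nu]_x f x - \int[nu]_x g x.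
Proof. by move=> bf bg; rewrite RintegralB //; exact: bc_integrable. Qed.

Lemma bc_RintegralZ nu c f : bounded_continuous f ->
  \int[nu]_x (c * f x) = c * \int[nu]_x f x.
Proof. by move=> bf; rewrite RintegralZl //; exact: bc_integrable. Qed.

Lemma Rintegral_cst_mass nu c : \int[nu]_x c = c * mass nu.
Proof. by rewrite Rintegral_cst. Qed.

Lemma bc_le_Rintegral nu f g : bounded_continuous f -> bounded_continuous g ->
  (forall x, f x <= g x) -> \int[nu]_x f x <= \int[nu]_x g x.
Proof.
by move=> bf bg fg; apply: le_Rintegral => //; exact: bc_integrable.
Qed.

Lemma bc_norm_Rintegral_le nu f g : bounded_continuous f -> bounded_continuous g ->
  (forall x, `|f x| <= g x) -> `|\int[nu]_x f x| <= \int[nu]_x g x.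
Proof.
move=> bf bg fg; rewrite ler_norml; apply/andP; split; last first.
  by apply: bc_le_Rintegral => // x; apply: le_trans (fg x); exact: ler_norm.
rewrite lerNl -mulN1r -bc_RintegralZ //; apply: bc_le_Rintegral => //; first exact: bcZ.
by move=> x; rewrite mulN1r; apply: le_trans (fg x); rewrite -normrN ler_norm.
Qed.

(** The form in which tightness is used: small on a compact set, merely bounded
    outside of it. *)
Lemma bc_norm_Rintegral_tail_le nu f (eps M K : R) : bounded_continuous f ->
  0 <= eps -> 0 <= M -> (forall x, `|x| <= K -> `|f x| <= eps) ->
  (forall x, `|f x| <= M) ->
  `|\int[nu]_x f x| <= eps * mass nu + M * tail_mass nu K.
Proof.
move=> bf e0 M0 fe fM.
have bnf : nu.-integrable setT (EFin \o (fun x => `|f x|)).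
  apply: bc_integrable; split; last by exists M => x; rewrite normr_id.
  by move=> x; apply: cvg_norm; exact: bf.1.
apply: le_trans (le_normr_Rintegral _ (bc_integrable _ bf)) _ => //.
have mT := measurable_norm_gt K.
have iT : nu.-integrable setT (EFin \o (\1_[set x : R | K < `|x|] : R -> R)).
  exact: integrable_indic.
have iZ : nu.-integrable setT
    (EFin \o (fun x => M * (\1_[set x : R | K < `|x|] : R -> R) x)).
  by under [X in _.-integrable _ X]eq_fun do rewrite /= EFinM; exact: integrableZl.
have ic := bc_integrable nu (bc_cst eps).
apply: (@le_trans _ _ (\int[nu]_x (eps + M * (\1_[set x : R | K < `|x|] : R -> R) x))).
  apply: le_Rintegral => //.
    by under [X in _.-integrable _ X]eq_fun do rewrite /= EFinD; exact: integrableD.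
  move=> x _; rewrite indicE; have [xK|xK] := leP `|x| K.
    rewrite memNset /= ?mulr0 ?addr0 ?fe //.
    by apply/negP; rewrite -leNgt.
  rewrite mem_set //= mulr1; apply: le_trans (fM x) _; by rewrite lerDr.
rewrite RintegralD // Rintegral_cst_mass RintegralZl // lerD2l ler_wpM2l //.
by rewrite /Rintegral integral_indic // setIT.
Qed.

(** The characteristic function has modulus [exp (- damping nu u)], and
    [jump_phase nu u] is the part of its argument that is not due to the drift. *)
Definition damping nu u := \int[nu]_x damp_kernel u x.
Definition jump_phase nu u := \int[nu]_x phase_kernel u x.

Lemma damping_ge0 nu u : 0 <= damping nu u.
Proof. by apply: Rintegral_ge0 => x _; exact: damp_kernel_ge0. Qed.

Lemma continuous_under (k : R -> R -> R) (B : R -> R) nu :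
  (forall u, bounded_continuous (k u)) -> (forall x, continuous (k ^~ x)) ->
  (forall u x, `|k u x| <= B `|u|) -> {homo B : x y / x <= y} ->
  continuous (fun u => \int[nu]_x k u x).
Proof.
move=> bk ck kB hB u.
have := @continuity_under_integral R _ _ nu k setT measurableT (u - 1) (u + 1) _ _
  (fun=> B (`|u| + 1)) _ _ u.
apply.
- by move=> v _; exact: bc_integrable.
- by apply: aeW => x _ v _; exact: ck.
- exact: (bc_integrable nu (bc_cst _)).
- move=> v; rewrite /= in_itv /= => /andP[uv vu].
  apply: aeW => x _; apply: le_trans (kB v x) _; apply: hB.
  by have := ler_norm u; have := ler_norm (- u); rewrite normrN ler_norml; lra.
- by rewrite inE /= in_itv /=; lra.
Qed.

Lemma sqr_max0_le x y : x <= y -> Num.max 0 x ^+ 2 <= Num.max 0 y ^+ 2.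
Proof.
move=> xy; have x0 : 0 <= Num.max 0 x by rewrite le_max lexx.
have y0 : 0 <= Num.max 0 y by rewrite le_max lexx.
by rewrite lerXn2r // ge_max y0 le_max xy orbT.
Qed.

Lemma continuous_damping nu : continuous (damping nu).
Proof.
apply: (@continuous_under damp_kernel (fun y => 2 + (Num.max 0 y) ^+ 2 / 2)).
- exact: bc_damp_kernel.
- exact: continuous_damp_kernel1.
- move=> u x; rewrite ger0_norm ?damp_kernel_ge0 //; apply: le_trans (damp_kernel_le u x) _.
  by rewrite max_r // real_normK ?num_real.
- move=> x y xy; rewrite lerD2l ler_wpM2r ?invr_ge0 //; exact: sqr_max0_le.
Qed.

Lemma continuous_jump_phase nu : continuous (jump_phase nu).
Proof.
apply: (@continuous_under phase_kernel (fun y => 1 + (Num.max 0 y) ^+ 2)).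
- exact: bc_phase_kernel.
- exact: continuous_phase_kernel1.
- by move=> u x; apply: le_trans (phase_kernel_le u x) _;
  rewrite max_r // real_normK ?num_real.
- move=> x y xy; rewrite lerD2l; exact: sqr_max0_le.
Qed.

Lemma damping_chord nu u w : damping nu u <= 2 * damping nu w + 2 * damping nu (u + w).
Proof.
rewrite -!bc_RintegralZ -?bc_RintegralD; try by [exact: bc_damp_kernel | apply: bcZ;
  exact: bc_damp_kernel].
apply: bc_le_Rintegral; first exact: bc_damp_kernel.
  by apply: bcD; apply: bcZ; exact: bc_damp_kernel.
by move=> x; exact: damp_kernel_chord.
Qed.

Lemma damping_defect nu eta u w : 0 < eta ->
  `|damping nu (u + w) - damping nu u - damping nu w| <=
  2 * (eta * damping nu u + damping nu w / eta).
Proof.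
move=> e0; rewrite [_ / eta]mulrC /damping.
have b := bc_damp_kernel.
rewrite -!bc_RintegralZ // -bc_RintegralD; [|exact: bcZ..].
rewrite -bc_RintegralZ; last by apply: bcD; exact: bcZ.
rewrite -!bc_RintegralB //; last exact: bcB.
apply: bc_norm_Rintegral_le; first by do 2 apply: bcB => //.
  by apply/bcZ/bcD; exact: bcZ.
by move=> x; rewrite [_^-1 * _]mulrC; exact: damp_kernel_defect.
Qed.

Lemma jump_phase_defect nu eta u w : 0 < eta ->
  `|jump_phase nu (u + w) - jump_phase nu u - jump_phase nu w| <=
  2 * (eta * damping nu u + damping nu w / eta).
Proof.
move=> e0; rewrite [_ / eta]mulrC /damping /jump_phase.
have b := bc_damp_kernel; have b' := bc_phase_kernel.
rewrite -!bc_RintegralZ // -bc_RintegralD; [|exact: bcZ..].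
rewrite -bc_RintegralZ; last by apply: bcD; exact: bcZ.
rewrite -!bc_RintegralB //; last exact: bcB.
apply: bc_norm_Rintegral_le; first by do 2 apply: bcB => //.
  by apply/bcZ/bcD; exact: bcZ.
by move=> x; rewrite [_^-1 * _]mulrC; exact: phase_kernel_defect.
Qed.

Lemma damping_second_diff nu u w :
  damping nu (u + w) + damping nu (u - w) - 2 * damping nu u =
  2 * \int[nu]_x (cos (u * x) * damp_kernel w x).
Proof.
have b := bc_damp_kernel; have bc := bc_cos; rewrite /damping.
rewrite -!bc_RintegralZ // -?bc_RintegralD // -?bc_RintegralB //;
  [|exact: bcD|exact: bcZ|exact: bcM].
by congr Rintegral; apply/funext => x; exact: damp_kernel_second_diff.
Qed.

Lemma jump_phase_second_diff nu u w :
  jump_phase nu (u + w) + jump_phase nu (u - w) - 2 * jump_phase nu u =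
  - 2 * \int[nu]_x (sin (u * x) * damp_kernel w x).
Proof.
have b := bc_damp_kernel; have b' := bc_phase_kernel; have bc := bc_sin;
  rewrite /jump_phase.
rewrite -!bc_RintegralZ // -?bc_RintegralD // -?bc_RintegralB //;
  [|exact: bcD|exact: bcZ|exact: bcM].
by congr Rintegral; apply/funext => x; exact: phase_kernel_second_diff.
Qed.

Lemma jump_phase_second_diff_le nu u w :
  `|jump_phase nu (u + w) + jump_phase nu (u - w) - 2 * jump_phase nu u| <=
    2 * damping nu w.
Proof.
rewrite jump_phase_second_diff normrM normrN (gtr0_norm (ltr0n R 2)) ler_wpM2l //.
apply: bc_norm_Rintegral_le; [|exact: bc_damp_kernel|].
  by apply: bcM; [exact: bc_sin|exact: bc_damp_kernel].
move=> x; rewrite normrM (ger0_norm (damp_kernel_ge0 w x)) ler_piMl ?damp_kernel_ge0 //.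
exact: sin_max.
Qed.

End bounded_continuous.

(** * Integrals over compact intervals *)

Section interval_integrals.
Context {R : realType}.
Implicit Types (f g : R -> R) (a b h u M x : R).
Local Notation mu := (@lebesgue_measure R).

Lemma itv_integrable f a b : continuous f -> mu.-integrable `[a, b] (EFin \o f).
Proof.
move=> cf; apply: continuous_compact_integrable; first exact: segment_compact.
exact: continuous_subspaceT.
Qed.

Lemma itv_int_cst a b M : a <= b -> \int[mu]_(x in `[a, b]) M = M * (b - a).
Proof.
move=> ab; rewrite Rintegral_cst //= lebesgue_measure_itv /= lte_fin.
by case: ltgtP ab => // ->; rewrite subrr.
Qed.

Lemma itv_int_le f g a b : continuous f -> continuous g ->
  (forall x, a <= x <= b -> f x <= g x) ->
  \int[mu]_(x in `[a, b]) f x <= \int[mu]_(x in `[a, b]) g x.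
Proof.
move=> cf cg fg; apply: le_Rintegral => //.
- exact: itv_integrable.
- exact: itv_integrable.
Qed.

Lemma itv_intD f g a b : continuous f -> continuous g ->
  \int[mu]_(x in `[a, b]) (f x + g x) =
  \int[mu]_(x in `[a, b]) f x + \int[mu]_(x in `[a, b]) g x.
Proof. by move=> cf cg; rewrite RintegralD //; exact: itv_integrable. Qed.

Lemma itv_intB f g a b : continuous f -> continuous g ->
  \int[mu]_(x in `[a, b]) (f x - g x) =
  \int[mu]_(x in `[a, b]) f x - \int[mu]_(x in `[a, b]) g x.
Proof. by move=> cf cg; rewrite RintegralB //; exact: itv_integrable. Qed.

Lemma itv_intZ f a b M : continuous f ->
  \int[mu]_(x in `[a, b]) (M * f x) = M * \int[mu]_(x in `[a, b]) f x.
Proof. by move=> cf; rewrite RintegralZl //; exact: itv_integrable. Qed.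

Lemma itv_int_norm_le f a b M : a <= b -> continuous f ->
  (forall x, a <= x <= b -> `|f x| <= M) ->
  `|\int[mu]_(x in `[a, b]) f x| <= M * (b - a).
Proof.
move=> ab cf fM; apply: le_trans (le_normr_Rintegral _ (itv_integrable _ _ cf)) _ => //.
rewrite -itv_int_cst //; apply: itv_int_le => //; last exact: cst_continuous.
by move=> x; apply: cvg_norm; exact: cf.
Qed.

Lemma itv_int_widen f a b c d : c <= a -> b <= d -> continuous f ->
  (forall x, 0 <= f x) ->
  \int[mu]_(x in `[a, b]) f x <= \int[mu]_(x in `[c, d]) f x.
Proof.
move=> ca bd cf f0; rewrite /Rintegral fine_le //.
- exact/integrable_fin_num/itv_integrable.
- exact/integrable_fin_num/itv_integrable.
- apply: ge0_subset_integral => //.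
  + by apply/measurable_EFinP/measurable_funTS; exact: continuous_measurable_fun.
  + by move=> x _; rewrite lee_fin.
  + by apply: subset_itv; rewrite bnd_simp.
Qed.

Lemma itv_int_shift f u h : 0 <= h -> continuous f ->
  \int[mu]_(w in `[0, h]) f (u + w) = \int[mu]_(v in `[u, u + h]) f v.
Proof.
move=> h0 cf; have dF x : is_derive x 1 (fun w : R => u + w) 1.
  by have := is_deriveD (is_derive_cst u x 1) (is_derive_id x 1); rewrite add0r.
have F'1 : derive1 (fun w : R => u + w) = fun=> 1.
  by apply/funext => x; rewrite derive1E; exact: derive_val.
have := @integration_by_substitution_increasing _ (fun w => u + w) f 0 h h0.
rewrite F'1 addr0 /Rintegral => ->.
- by congr fine; apply: eq_integral => x _ /=; rewrite /= mulr1.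
- by move=> x y _ _; rewrite ltrD2l.
- by move=> x _; exact: cst_continuous.
- exact: is_cvg_cst.
- exact: is_cvg_cst.
- have cF : continuous (fun w : R => u + w).
    by move=> x; apply: cvgD; [exact: cst_continuous|exact: cvg_id].
  split.
  + by move=> x _; have := dF x; case.
  + exact/cvg_at_right_filter/cF.
  + exact/cvg_at_left_filter/cF.
- exact: continuous_subspaceT.
Qed.

(** The comparison of a translate of [f] with combinations of [f1] and [f2] that
    occurs when [phi (u + w)] is compared with [phi u * phi w], where [u] is
    fixed and [w] is averaged. *)
Lemma itv_int_shift_lin (f f1 f2 : R -> R) (c1 c2 : R) u h : 0 <= h ->
  continuous f -> continuous f1 -> continuous f2 ->
  \int[mu]_(v in `[u, u + h]) f v -
    (c1 * \int[mu]_(w in `[0, h]) f1 w + c2 * \int[mu]_(w in `[0, h]) f2 w) =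
  \int[mu]_(w in `[0, h]) (f (u + w) - (c1 * f1 w + c2 * f2 w)).
Proof.
move=> h0 cf cf1 cf2.
have cM (c : R) (g : R -> R) : continuous g -> continuous (fun w => c * g w).
  by move=> cg w; apply: cvgM; [exact: cst_continuous|exact: cg].
have cu : continuous (fun w => f (u + w)).
  move=> w; apply: (@continuous_comp _ _ _ (fun w => u + w) f); last exact: cf.
  by apply: cvgD; [exact: cst_continuous|exact: cvg_id].
have cs : continuous (fun w => c1 * f1 w + c2 * f2 w).
  by move=> w; apply: cvgD; exact: cM.
rewrite (itv_intB _ _ cu cs) (itv_intD _ _ (cM _ _ cf1) (cM _ _ cf2)).
by rewrite !itv_intZ // itv_int_shift.
Qed.

Lemma itv_int_cos h x : 0 < h -> x != 0 ->
  \int[mu]_(u in `[0, h]) cos (u * x) = sin (h * x) / x.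
Proof.
move=> h0 x0; have dF u : is_derive u 1 (fun u : R => sin (u * x) / x) (cos (u * x)).
  have d1 : is_derive u 1 (fun v : R => v * x) x.
    have := @is_deriveM R R id (cst x) u 1 1 0 (is_derive_id _ _) (is_derive_cst _ _ _).
    by rewrite scaler0 add0r /= [_ *: _]mulr1.
  have d2 := @is_derive1_comp R sin (fun v : R => v * x) u _ _ (is_derive_sin _) d1.
  have := @is_deriveZ R R R (sin \o (fun v => v * x)) x^-1 u 1 _ d2.
  rewrite [x^-1 *: _](_ : _ = cos (u * x)).
    suff -> : (fun v : R => sin (v * x) / x) = x^-1 \*: (sin \o (fun v => v * x)) by [].
    by apply/funext => v; rewrite /= mulrC.
  by rewrite /GRing.scale /= mulrCA mulVf // mulr1.
have cF : continuous (fun u : R => sin (u * x) / x).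
  by move=> u; apply/differentiable_continuous/derivable1_diffP; have := dF u; case.
have cc : continuous (fun u : R => cos (u * x)).
  by move=> u; apply: (@continuous_comp _ _ _ (fun u : R => u * x) cos);
    [exact: continuous_mulr|exact: continuous_cos].
rewrite /Rintegral (@continuous_FTC2 _ _ (fun u => sin (u * x) / x)) //=.
- by rewrite mul0r sin0 mul0r subr0.
- exact: continuous_subspaceT.
- split.
  + by move=> u _; have := dF u; case.
  + exact/cvg_at_right_filter/cF.
  + exact/cvg_at_left_filter/cF.
- by move=> u _; rewrite derive1E; exact: derive_val.
Qed.

End interval_integrals.

Lemma continuous_cos_mulr {R : realType} (x : R) :
  continuous (fun u : R => cos (u * x)).
Proof.
by move=> u; apply: (@continuous_comp _ _ _ (fun u : R => u * x) cos);
  [exact: continuous_mulr|exact: continuous_cos].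
Qed.

(** * Tightness from the behaviour at small frequencies *)

Section tightness.
Context {R : realType}.
Implicit Types (nu : finite_borel_measure R) (h eps x : R).
Local Notation mu := (@lebesgue_measure R).

Lemma mean_one_sub_cos h x : 0 < h -> 2 / h < `|x| ->
  h / 2 <= \int[mu]_(u in `[0, h]) (1 - cos (u * x)).
Proof.
move=> h0 hx; have xp : 0 < `|x| by apply: le_lt_trans hx; rewrite divr_ge0 // ltW.
have x0 : x != 0 by rewrite -normr_gt0.
rewrite itv_intB; [|exact: cst_continuous|exact: continuous_cos_mulr].
rewrite (itv_int_cst _ (ltW h0)) itv_int_cos // mul1r subr0.
have : `|sin (h * x) / x| <= h / 2.
  rewrite normrM normfV ler_pdivrMr //; apply: le_trans (sin_max _) _.
  move: hx; rewrite ltr_pdivrMr //; move: `|x| => y hx. lra.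
by rewrite ler_norml; lra.
Qed.

(** Small frequencies see the tails: averaging [1 - cos (u x)] over
    [0 <= u <= h] gives at least one half as soon as [|x| > 2 / h], and by
    Tonelli's theorem the average of [damping nu] dominates one half of the mass
    of this region. *)
Lemma tail_mass_le nu h eps : 0 < h -> 0 <= eps ->
  (forall u, 0 <= u <= h -> damping nu u <= eps) -> tail_mass nu (2 / h) <= 2 * eps.
Proof.
move=> h0 e0 ge.
pose F (z : measurableTypeR R * measurableTypeR R) : \bar R :=
  ((\1_(`[0, h]%classic : set R) z.1 : R) * (1 - cos (z.1 * z.2)))%:E.
have F0 z : (0 <= F z)%E.
  by rewrite lee_fin mulr_ge0 // one_sub_cos_ge0.
have mF : measurable_fun setT F.
  apply/measurable_EFinP; apply: measurable_funM.
    apply: measurableT_comp measurable_fst.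
    by apply: measurable_indic; exact: measurable_itv.
  apply: measurable_funB => //.
  apply: (@measurableT_comp _ _ _ _ _ _ (cos : R -> R)).
    by apply: continuous_measurable_fun; exact: continuous_cos.
  exact: measurable_funM measurable_fst measurable_snd.
have E := @fubini_tonelli _ _ _ _ _ mu nu F mF F0.
have mT := measurable_norm_gt (2 / h).
have lhs : (\int[mu]_u \int[nu]_x F (u, x) <= (eps * h)%:E)%E.
  apply: (@le_trans _ _ (\int[mu]_u (eps * \1_(`[0, h]%classic : set R) u)%:E)%E).
    apply: ge0_le_integral => //.
    - by move=> u _; apply: integral_ge0.
    - exact: (measurable_fun_fubini_tonelli_F F).
    - by apply/measurable_EFinP/measurable_funM.
    - move=> u _; rewrite /F /=; rewrite indicE; case: (boolP (u \in _)).
        rewrite inE /= in_itv /= => hu; rewrite mulr1.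
        under eq_integral do rewrite mul1r.
        have b1 : bounded_continuous (fun x : R => 1 - cos (u * x)).
          by apply: bcB; [exact: bc_cst|exact: bc_cos].
        have i1 := bc_integrable nu b1.
        rewrite -(fineK (integrable_fin_num measurableT i1)) lee_fin.
        apply: le_trans (ge _ hu); apply: bc_le_Rintegral => //;
          first exact: bc_damp_kernel.
        by move=> x; exact: one_sub_cos_le_damp_kernel.
      by move=> _; under eq_integral do rewrite mul0r; rewrite integral0 mulr0.
  under eq_integral do rewrite EFinM.
  rewrite ge0_integralZl_EFin //; last exact/measurable_EFinP.
  rewrite integral_indic // setIT /= lebesgue_measure_itv /= lte_fin h0 -EFinB -EFinM.
  by rewrite subr0.
have rhs : ((h / 2 * tail_mass nu (2 / h))%:E <= \int[nu]_x \int[mu]_u F (u, x))%E.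
  have -> : ((h / 2 * tail_mass nu (2 / h))%:E =
     \int[nu]_x (h / 2 * (\1_[set x : R | 2 / h < `|x|] : R -> R) x)%:E)%E.
    under eq_integral do rewrite EFinM.
    rewrite ge0_integralZl_EFin //; last by rewrite divr_ge0 // ltW.
    2: exact/measurable_EFinP/measurable_indic.
    by rewrite integral_indic // setIT EFinM /tail_mass fineK // fin_num_measure.
  apply: ge0_le_integral => //.
  - by move=> x _; rewrite lee_fin mulr_ge0 // divr_ge0 // ltW.
  - by apply/measurable_EFinP/measurable_funM.
  - exact: (measurable_fun_fubini_tonelli_G F).
  - move=> x _; rewrite indicE; case: (boolP (x \in _)).
      rewrite inE /= mulr1 => hx.
      rewrite [leRHS](_ : _ = (\int[mu]_(u in `[0, h]) (1 - cos (u * x)))%:E).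
        by rewrite lee_fin; exact: mean_one_sub_cos.
      rewrite fineK; last first.
        apply: integrable_fin_num => //; apply: itv_integrable => u.
        apply: cvgB; first exact: cst_continuous.
        exact: continuous_cos_mulr.
      rewrite [RHS]integral_mkcond; apply: eq_integral => u _.
      rewrite /F /= indicE patchE; case: ifP => _; first by rewrite mul1r.
      by rewrite mul0r.
    by move=> _; rewrite mulr0; apply: integral_ge0.
have := le_trans rhs (le_trans _ lhs); rewrite E lexx => /(_ isT).
by rewrite lee_fin => k; nra.
Qed.

(** Inside the region [|x| <= 2 / h] the kernel [damp_kernel h] is bounded
    below, so that [damping nu h] alone controls the mass there. *)
Lemma mass_le nu h eps : 0 < h ->
  (forall u, 0 <= u <= h -> damping nu u <= eps) ->
  mass nu <= 2 * eps + 8 * eps / h ^+ 2.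
Proof.
move=> h0 ge; have e0 : 0 <= eps.
  by apply: le_trans (damping_ge0 nu 0) (ge _ _); rewrite lexx ltW.
have T := tail_mass_le h0 e0 ge.
have gh : damping nu h <= eps by apply: ge; rewrite lexx ltW.
have iT : nu.-integrable setT (EFin \o (\1_[set x : R | 2 / h < `|x|] : R -> R)).
  by apply: integrable_indic; exact: measurable_norm_gt.
have i1 := bc_integrable nu (bc_cst 1).
have h8 : 0 <= h ^+ 2 / 8 by rewrite divr_ge0 // sqr_ge0.
have iB : nu.-integrable setT (EFin \o (fun x =>
  1 - (\1_[set x : R | 2 / h < `|x|] : R -> R) x)).
  by under [X in _.-integrable _ X]eq_fun do rewrite /= EFinB; exact: integrableB.
have : \int[nu]_x (h ^+ 2 / 8 * (1 - (\1_[set x : R | 2 / h < `|x|] : R -> R) x)) <=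
    damping nu h.
  apply: le_Rintegral => //.
  - by under [X in _.-integrable _ X]eq_fun do rewrite /= EFinM; exact: integrableZl.
  - exact/bc_integrable/bc_damp_kernel.
  - move=> x _; rewrite indicE; case: (boolP (x \in _)).
      by move=> _; rewrite subrr mulr0 damp_kernel_ge0.
    rewrite notin_setE /= => /negP; rewrite -leNgt => hx.
    rewrite subr0 mulr1; apply: damp_kernel_lower.
    by move: hx; rewrite normrM (gtr0_norm h0) ler_pdivlMr // mulrC.
rewrite RintegralZl // RintegralB // Rintegral_cst_mass mul1r.
rewrite [X in _ - X](_ : _ = tail_mass nu (2 / h)); last first.
  by rewrite /Rintegral integral_indic ?setIT //; exact: measurable_norm_gt.
move=> k; have {k gh} k : h ^+ 2 / 8 * (mass nu - tail_mass nu (2 / h)) <=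
  eps by apply: le_trans gh.
have h2 : 0 < h ^+ 2 by rewrite exprn_gt0.
suff : mass nu - tail_mass nu (2 / h) <= 8 * eps / h ^+ 2 by lra.
by rewrite ler_pdivlMr //; lra.
Qed.

End tightness.

(** * Weierstrass approximation by trigonometric polynomials *)

Section weierstrass.
Context {R : realType}.
Implicit Types (s : nat -> R) (f g : R -> R) (n k : nat) (t x c K M eps : R).

(** The Bernstein polynomial of degree [n] with values [s 0, ..., s n] at the
    nodes, computed by conditioning on the first of [n] coin flips; linearity,
    monotonicity and moments then follow by induction without binomial sums. *)
Fixpoint bernstein n s t : R :=
  if n is m.+1 then (1 - t) * bernstein m s t + t * bernstein m (s \o succn) t
  else s 0%N.

Lemma bernsteinD n s s' t :
  bernstein n (fun k => s k + s' k) t = bernstein n s t + bernstein n s' t.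
Proof.
by elim: n s s' => //= n IH s s'; rewrite IH [bernstein n (_ \o _) _]IH; ring.
Qed.

Lemma bernsteinZ n s c t : bernstein n (fun k => c * s k) t = c * bernstein n s t.
Proof.
by elim: n s => //= n IH s; rewrite IH [bernstein n (_ \o _) _]IH; ring.
Qed.

Lemma bernstein_cst n c t : bernstein n (fun=> c) t = c.
Proof. by elim: n => //= n IH; rewrite IH; ring. Qed.

(** The nodes beyond [n] carry no weight. *)
Lemma bernstein_le n s s' t : 0 <= t <= 1 ->
  (forall k, (k <= n)%N -> s k <= s' k) -> bernstein n s t <= bernstein n s' t.
Proof.
move=> /andP[t0 t1]; elim: n s s' => [|n IH] s s' ss' /=; first exact: ss'.
apply: lerD; rewrite ler_wpM2l ?subr_ge0 //; apply: IH => k kn; apply: ss' => //.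
exact: leqW.
Qed.

(** The second moment about [c] of the binomial distribution: its variance plus
    the squared distance from its mean to [c]. *)
Lemma bernstein_sqr n c t :
  bernstein n (fun k => (k%:R - c) ^+ 2) t =
  n%:R * t * (1 - t) + (n%:R * t - c) ^+ 2.
Proof.
elim: n c => [|n IH] c /=; first by rewrite mulr0n; ring.
rewrite IH (_ : (fun k => (k%:R - c) ^+ 2) \o succn =
  (fun k => (k%:R - (c - 1)) ^+ 2)); last first.
  by apply/funext => k /=; rewrite -natr1; congr (_ ^+ 2); ring.
by rewrite IH -natr1; ring.
Qed.

Lemma uniform_continuity f K eps : continuous f -> 0 < eps ->
  exists2 del, 0 < del &
    forall x y, -K <= x <= K -> `|y - x| < del -> `|f y - f x| <= eps.
Proof.
move=> cf e0; have := @segment_compact R (- K) K.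
move=> /compact_near_coveringP /(_ _ (0 : R)^'+
  (fun d x => forall y, `|y - x| < d -> `|f y - f x| <= eps) _).
case.
  move=> x _; have /cvgrPdist_lt /(_ (eps / 2)) := cf x.
  rewrite divr_gt0 // => /(_ isT) /nbhs_ballP[r /= r0 hr].
  near=> x' d => y yx'.
  have h z : `|z - x| < r -> `|f x - f z| < eps / 2.
    by move=> zx; apply: (hr z); rewrite /ball /= distrC.
  have x'r : `|x' - x| < r / 2.
    near: x'; apply/nbhs_ballP; exists (r / 2) => /=; first by rewrite divr_gt0.
    by move=> z; rewrite /ball /= distrC.
  have dr : d < r / 2 by near: d; apply: nbhs_right_lt; rewrite divr_gt0.
  have hx' : `|f x - f x'| < eps / 2 by apply: h; lra.
  have hy : `|f x - f y| < eps / 2.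
    apply: h; apply: le_lt_trans (ler_distD x' y x) _.
    by rewrite [ltRHS]splitr; apply: ltrD => //; exact: lt_trans dr.
  by have := ler_distD (f x) (f y) (f x'); rewrite [`|f y - f x|]distrC; lra.
move=> r /= r0 hr; exists (r / 2); first by rewrite divr_gt0.
move=> x y xK; apply: hr => //=.
- by rewrite sub0r normrN gtr0_norm ?divr_gt0 //; lra.
- by rewrite divr_gt0.
Unshelve. all: by end_near. Qed.

(** Bernstein's proof: [|f (k / n) - f t|] is at most [eps / 2] near [t] and at
    most a multiple of [(k / n - t) ^ 2] away from [t], and the binomial mean of
    the latter is of order [1 / n]. *)
Lemma bernstein_approx f eps M : continuous f -> (forall x, `|f x| <= M) ->
  0 < eps -> exists n,
    forall t, 0 <= t <= 1 -> `|bernstein n (fun k => f (k%:R / n%:R)) t - f t| <= eps.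
Proof.
move=> cf fM e0; have e2 : 0 < eps / 2 by rewrite divr_gt0.
have [del d0 hd] := uniform_continuity 1 cf e2.
have M0 : 0 <= M by apply: le_trans (fM 0).
have [n hn] : exists n : nat, 4 * M / (del ^+ 2 * eps) < n%:R.
  by exists (Num.bound (4 * M / (del ^+ 2 * eps))); apply: archi_boundP;
    rewrite divr_ge0 ?mulr_ge0 ?sqr_ge0 // ltW.
have n0 : 0 < n%:R :> R.
  by apply: le_lt_trans hn; rewrite divr_ge0 ?mulr_ge0 ?sqr_ge0 // ltW.
exists n => t t01; set A := 2 * M / del ^+ 2 / n%:R ^+ 2.
have d2 : 0 < del ^+ 2 by rewrite exprn_gt0.
have h k : `|f (k%:R / n%:R) - f t| <= eps / 2 + A * (k%:R - n%:R * t) ^+ 2.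
  have -> : A * (k%:R - n%:R * t) ^+ 2 = 2 * M * ((k%:R / n%:R - t) ^+ 2 / del ^+ 2).
    by rewrite /A; field; rewrite !gt_eqF.
  set z := k%:R / n%:R; have [zd|zd] := ltP `|z - t| del.
    apply: le_trans (hd t z _ zd) _; first by lra.
    by rewrite lerDl mulr_ge0 ?divr_ge0 ?sqr_ge0 // mulr_ge0.
  have : 1 <= (z - t) ^+ 2 / del ^+ 2.
    rewrite ler_pdivlMr // mul1r -(real_normK (num_real (z - t))).
    by rewrite lerXn2r ?nnegrE ?normr_ge0 // ltW.
  set q := _ / _ => q1; have : `|f z - f t| <= 2 * M.
    by apply: le_trans (ler_normB _ _) _; have := fM z; have := fM t; lra.
  have : 2 * M <= 2 * M * q by rewrite ler_peMr // mulr_ge0.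
  lra.
have E c : bernstein n (fun k => c * (f (k%:R / n%:R) - f t)) t =
    c * (bernstein n (fun k => f (k%:R / n%:R)) t - f t).
  rewrite bernsteinZ; congr (_ * _).
  by rewrite (bernsteinD _ _ (fun=> - f t)) bernstein_cst.
have V : bernstein n (fun k => eps / 2 + A * (k%:R - n%:R * t) ^+ 2) t <= eps.
  rewrite (bernsteinD _ (fun=> eps / 2)) bernstein_cst bernsteinZ bernstein_sqr.
  rewrite subrr expr0n /= addr0.
  have -> : A * (n%:R * t * (1 - t)) = 2 * M * (t * (1 - t)) / (del ^+ 2 * n%:R).
    by rewrite /A; field; rewrite !gt_eqF.
  have : 2 * M * (t * (1 - t)) / (del ^+ 2 * n%:R) <= eps / 2.
    rewrite ler_pdivrMr ?mulr_gt0 //.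
    move: hn; rewrite ltr_pdivrMr ?mulr_gt0 // => hn.
    have : 2 * M * (t * (1 - t)) <= 2 * M * 1.
      by rewrite ler_wpM2l ?mulr_ge0 //; nra.
    lra.
  lra.
rewrite ler_norml; apply/andP; split.
  rewrite lerNl -mulN1r -E; apply: le_trans V; apply: bernstein_le => // k _.
  by apply: le_trans (h k); rewrite mulN1r -normrN ler_norm.
rewrite -[leLHS]mul1r -E; apply: le_trans V; apply: bernstein_le => // k _.
by apply: le_trans (h k); rewrite mul1r ler_norm.
Qed.

Lemma bernstein_norm_le n s t M : 0 <= t <= 1 -> (forall k, `|s k| <= M) ->
  `|bernstein n s t| <= M.
Proof.
move=> t01 sM; rewrite ler_norml -{1}(bernstein_cst n (- M) t).
rewrite -{2}(bernstein_cst n M t); apply/andP; split; apply: bernstein_le => // k _.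
  by have := sM k; rewrite ler_norml => /andP[].
by have := sM k; rewrite ler_norml => /andP[].
Qed.

Definition clamp K x : R := Num.min K (Num.max (- K) x).

Lemma clamp_id K x : `|x| <= K -> clamp K x = x.
Proof.
by rewrite ler_norml /clamp => /andP[h1 h2]; rewrite max_r // min_r.
Qed.

Lemma clamp_le K x : 0 <= K -> `|clamp K x| <= K.
Proof.
move=> K0; rewrite /clamp ler_norml ge_min lexx /= andbT.
by rewrite le_min le_max lexx andbT; lra.
Qed.

Lemma clamp_far K x : 0 <= K -> K < `|x| -> `|clamp K x| = K.
Proof.
move=> K0; rewrite /clamp; have [x0|x0] := leP 0 x.
  rewrite (ger0_norm x0) => Kx; rewrite max_r; last lra.
  by rewrite min_l ?ger0_norm // ltW.
rewrite (ltr0_norm x0) => Kx; rewrite max_l; last lra.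
by rewrite min_r ?normrN ?ger0_norm //; lra.
Qed.

Lemma continuous_clamp K : continuous (clamp K).
Proof.
move=> x; apply: (@continuous_min _ _ (fun=> K) (fun x => Num.max (- K) x)).
  exact: cst_continuous.
by apply: (@continuous_max _ _ (fun=> - K) id); [exact: cst_continuous|exact: cvg_id].
Qed.

Lemma sin1_lt1 : sin 1 < 1 :> R.
Proof.
have := cos2Dsin2 (1 : R); have := cos1_gt0 R; have := sin_le1 (1 : R).
by rewrite !expr2; nra.
Qed.

Lemma sin1_gt0 : 0 < sin 1 :> R.
Proof. by apply: sin2_gt0; rewrite ltr01 ltr1n. Qed.

(** Weierstrass's theorem for trigonometric polynomials, presented as Bernstein
    polynomials in [(1 + sin (x / K)) / 2]: this quantity is increasing on
    [[-K, K]] and never leaves [[0, 1]], so that the approximant is close to [f]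
    on [[-K, K]] and bounded by [sup |f|] everywhere. *)
Lemma trigonometric_approx f K eps M : continuous f -> (forall x, `|f x| <= M) ->
  0 < K -> 0 < eps -> exists n s,
    (forall x, `|bernstein n s ((1 + sin (K^-1 * x)) / 2)| <= M) /\
    (forall x, `|x| <= K ->
       `|f x - bernstein n s ((1 + sin (K^-1 * x)) / 2)| <= eps).
Proof.
move=> cf fM K0 e0.
(* The clamp keeps the argument of [asin] inside the open interval on which it
   is continuous; on [[-K, K]] the values [sin (x / K)] are not affected. *)
pose g t := f (K * asin (clamp (sin 1) (2 * t - 1))).
have cg : continuous g.
  move=> t; apply: (@continuous_comp _ _ _
    (fun t => K * asin (clamp (sin 1) (2 * t - 1))) f); last exact: cf.
  apply: cvgM; first exact: cst_continuous.
  apply: (@continuous_comp _ _ _ (fun t => clamp (sin 1) (2 * t - 1)) asin).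
    apply: (@continuous_comp _ _ _ (fun t => 2 * t - 1) (clamp (sin 1))).
      by apply: cvgB; [exact: continuous_mull|exact: cst_continuous].
    exact: continuous_clamp.
  apply: continuous_asin; rewrite -ltr_norml.
  by apply: le_lt_trans sin1_lt1; apply: clamp_le; exact/ltW/sin1_gt0.
have gM t : `|g t| <= M by exact: fM.
have [n hn] := bernstein_approx cg gM e0.
have t01 x : 0 <= (1 + sin (K^-1 * x)) / 2 <= 1.
  by have := sin_le1 (K^-1 * x); have := sin_geN1 (K^-1 * x); lra.
exists n, (fun k => g (k%:R / n%:R)); split=> x.
  by apply: bernstein_norm_le => // k; exact: gM.
move=> xK; have z1 : `|K^-1 * x| <= 1.
  by rewrite normrM normfV (gtr0_norm K0) mulrC ler_pdivrMr // mul1r.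
have -> : f x = g ((1 + sin (K^-1 * x)) / 2).
  rewrite /g; have -> : 2 * ((1 + sin (K^-1 * x)) / 2) - 1 = sin (K^-1 * x) by field.
  have p2 : 1 <= pi / 2 :> R by exact: pihalf_ge1.
  have sinK1 (z : R) : `|z| <= 1 -> z \in `[(- (pi / 2)), (pi / 2)].
    rewrite ler_norml in_itv /= => /andP[z1' z2']; apply/andP; split.
      by apply: (le_trans _ z1'); rewrite lerN2.
    exact: le_trans z2' p2.
  rewrite clamp_id; last first.
    have [zge zle] : -1 <= K^-1 * x /\ K^-1 * x <= 1 by apply/andP; rewrite -ler_norml.
    have mono : {in `[(- (pi / 2)), (pi / 2)] &, {mono (@sin R) : y z / y <= z}}.
      by apply: le_mono_in => y z hy hz; rewrite ltr_sin.
    rewrite ler_norml -sinN !mono ?sinK1 ?zge ?zle //.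
    - by rewrite normr1.
    - by rewrite normrN normr1.
  by rewrite sinK ?sinK1 // mulrA divff ?mul1r // gt_eqF.
by rewrite distrC; exact: hn.
Qed.

End weierstrass.

(** * Weak convergence from convergence of weighted Fourier transforms *)

Section weak_convergence.
Context {R : realType}.
Implicit Types (mu nu : finite_borel_measure R) (k f g : R -> R).
Implicit Types (x u w c K M eps : R).

Lemma cvg_approx (x_ : nat -> R) (x : R) :
  (forall eps, 0 < eps -> exists a_ : nat -> R, exists a : R,
     [/\ a_ n @[n --> \oo] --> a, \forall n \near \oo, `|x_ n - a_ n| <= eps &
         `|x - a| <= eps]) ->
  x_ n @[n --> \oo] --> x.
Proof.
move=> h; apply/cvgrPdist_le => e e0.
have [|a_ [a [/cvgrPdist_le aa xa_ xa]]] := h (e / 3); first by rewrite divr_gt0.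
have e3 : 0 < e / 3 by rewrite divr_gt0.
have := aa _ e3; apply: filterS2 xa_ => n h1 h2.
have := ler_distD a x (x_ n); have := ler_distD (a_ n) a (x_ n).
by rewrite [`|a_ n - x_ n|]distrC; lra.
Qed.

Definition controlled eps M K nu := tail_mass nu K <= eps /\ mass nu <= M.

Definition tight (nu_ : nat -> finite_borel_measure R) nu :=
  exists M, forall eps, 0 < eps -> exists2 K, 0 < K &
    controlled eps M K nu /\ \forall n \near \oo, controlled eps M K (nu_ n).

Lemma tail_mass_anti nu K K' : K <= K' -> tail_mass nu K' <= tail_mass nu K.
Proof.
move=> KK'; rewrite fine_le ?fin_num_measure //; try exact: measurable_norm_gt.
apply: le_measure; rewrite ?inE; try exact: measurable_norm_gt.
by move=> x /=; exact: le_lt_trans.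
Qed.

Section weighted.
Variables (nu_ : nat -> finite_borel_measure R) (nu : finite_borel_measure R).
Variable k : R -> R.
Hypothesis bk : bounded_continuous k.

(** The functions along which the Fourier transforms of the weighted measures
    [f k dnu_n] converge pointwise. *)
Definition fourier_cvg f := bounded_continuous f /\ forall u,
  \int[nu_ n]_x (cos (u * x) * (f x * k x)) @[n --> \oo] -->
    \int[nu]_x (cos (u * x) * (f x * k x)) /\
  \int[nu_ n]_x (sin (u * x) * (f x * k x)) @[n --> \oo] -->
    \int[nu]_x (sin (u * x) * (f x * k x)).

Lemma bc_cos_weight f u : bounded_continuous f ->
  bounded_continuous (fun x => cos (u * x) * (f x * k x)).
Proof. by move=> bf; apply: bcM; [exact: bc_cos|exact: bcM]. Qed.

Lemma bc_sin_weight f u : bounded_continuous f ->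
  bounded_continuous (fun x => sin (u * x) * (f x * k x)).
Proof. by move=> bf; apply: bcM; [exact: bc_sin|exact: bcM]. Qed.

Lemma fourier_cvgD f g : fourier_cvg f -> fourier_cvg g ->
  fourier_cvg (fun x => f x + g x).
Proof.
move=> [bf hf] [bg hg]; split=> [|u]; first exact: bcD.
have [hf1 hf2] := hf u; have [hg1 hg2] := hg u.
have E1 mu : \int[mu]_x (cos (u * x) * ((f x + g x) * k x)) =
    \int[mu]_x (cos (u * x) * (f x * k x)) + \int[mu]_x (cos (u * x) * (g x * k x)).
  rewrite -bc_RintegralD; [|exact: bc_cos_weight..].
  by congr Rintegral; apply/funext => x; ring.
have E2 mu : \int[mu]_x (sin (u * x) * ((f x + g x) * k x)) =
    \int[mu]_x (sin (u * x) * (f x * k x)) + \int[mu]_x (sin (u * x) * (g x * k x)).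
  rewrite -bc_RintegralD; [|exact: bc_sin_weight..].
  by congr Rintegral; apply/funext => x; ring.
rewrite E1 E2; under eq_fun do rewrite E1.
under [X in _ /\ (X @ _ --> _)]eq_fun do rewrite E2.
by split; apply: cvgD.
Qed.

Lemma fourier_cvgZ c f : fourier_cvg f -> fourier_cvg (fun x => c * f x).
Proof.
move=> [bf hf]; split=> [|u]; first exact: bcZ.
have [hf1 hf2] := hf u.
have E1 mu : \int[mu]_x (cos (u * x) * ((c * f x) * k x)) =
    c * \int[mu]_x (cos (u * x) * (f x * k x)).
  rewrite -bc_RintegralZ; [|exact: bc_cos_weight].
  by congr Rintegral; apply/funext => x; ring.
have E2 mu : \int[mu]_x (sin (u * x) * ((c * f x) * k x)) =
    c * \int[mu]_x (sin (u * x) * (f x * k x)).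
  rewrite -bc_RintegralZ; [|exact: bc_sin_weight].
  by congr Rintegral; apply/funext => x; ring.
rewrite E1 E2; under eq_fun do rewrite E1.
under [X in _ /\ (X @ _ --> _)]eq_fun do rewrite E2.
by split; apply: cvgMr.
Qed.

(** Products of sines and cosines are combinations of sines and cosines of other
    frequencies; this is why convergence is required at all [u]. *)
Lemma fourier_cvg_sin c f : fourier_cvg f ->
  fourier_cvg (fun x => sin (c * x) * f x).
Proof.
move=> [bf hf]; split=> [|u]; first by apply: bcM => //; exact: bc_sin.
have [hm1 hm2] := hf (u - c); have [hp1 hp2] := hf (u + c).
have E1 mu : \int[mu]_x (cos (u * x) * (sin (c * x) * f x * k x)) =
    2^-1 * (\int[mu]_x (sin ((u + c) * x) * (f x * k x)) -
            \int[mu]_x (sin ((u - c) * x) * (f x * k x))).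
  rewrite -bc_RintegralB; [|exact: bc_sin_weight..].
  rewrite -bc_RintegralZ; last by apply: bcB; exact: bc_sin_weight.
  congr Rintegral; apply/funext => x.
  by rewrite [(u + c) * x]mulrDl [(u - c) * x]mulrBl sinD sinB; field.
have E2 mu : \int[mu]_x (sin (u * x) * (sin (c * x) * f x * k x)) =
    2^-1 * (\int[mu]_x (cos ((u - c) * x) * (f x * k x)) -
            \int[mu]_x (cos ((u + c) * x) * (f x * k x))).
  rewrite -bc_RintegralB; [|exact: bc_cos_weight..].
  rewrite -bc_RintegralZ; last by apply: bcB; exact: bc_cos_weight.
  congr Rintegral; apply/funext => x.
  by rewrite [(u + c) * x]mulrDl [(u - c) * x]mulrBl cosB cosD; field.
rewrite E1 E2; under eq_fun do rewrite E1.
under [X in _ /\ (X @ _ --> _)]eq_fun do rewrite E2.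
by split; apply: cvgMr; apply: cvgB.
Qed.

Hypothesis fourier1 : fourier_cvg (fun=> 1).
Hypothesis tight_nu : tight nu_ nu.

Lemma fourier_cvg_bernstein c m s :
  fourier_cvg (fun x => bernstein m s ((1 + sin (c * x)) / 2)).
Proof.
elim: m s => [|m IH] s /=.
  have := fourier_cvgZ (s 0%N) fourier1.
  by under eq_fun do rewrite mulr1.
pose p x := bernstein m s ((1 + sin (c * x)) / 2).
pose q x := bernstein m (s \o succn) ((1 + sin (c * x)) / 2).
have hp : fourier_cvg p by exact: IH.
have hq : fourier_cvg q by exact: IH.
have h := fourier_cvgD (fourier_cvgZ 2^-1 (fourier_cvgD hp hq))
  (fourier_cvgZ 2^-1 (fourier_cvg_sin c (fourier_cvgD hq (fourier_cvgZ (-1) hp)))).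
by congr fourier_cvg: h; apply/funext => x; rewrite /p /q; field.
Qed.

(** Levy's continuity theorem for the measures [k dnu_n]: tightness reduces a
    bounded continuous [f] to a compact interval, where it is approximated by a
    trigonometric polynomial with the same bound on the whole line. *)
Lemma levy_continuity f : bounded_continuous f ->
  \int[nu_ n]_x (f x * k x) @[n --> \oo] --> \int[nu]_x (f x * k x).
Proof.
move=> bf; have [cf [B fB]] := bf; have [ck [C kC]] := bk.
have [M tM] := tight_nu.
have B0 : 0 <= B by apply: le_trans (fB 0).
have C0 : 0 <= C by apply: le_trans (kC 0).
have M0 : 0 <= M.
  have [K _ [[_ h] _]] := tM 1 ltr01; exact: le_trans (mass_ge0 nu) h.
apply: cvg_approx => eps e0.
set e1 := eps / 2 / (C * M + 1); set e2 := eps / 2 / (2 * B * C + 1).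
have CM : 0 < C * M + 1 by rewrite ltr_wpDl // mulr_ge0.
have BC : 0 < 2 * B * C + 1 by rewrite ltr_wpDl // !mulr_ge0.
have e1p : 0 < e1 by rewrite !divr_gt0.
have e2p : 0 < e2 by rewrite !divr_gt0.
have [K K0 [hK nK]] := tM _ e2p.
have [m [s [pB pe]]] := trigonometric_approx cf fB K0 e1p.
set p := fun x => bernstein m s ((1 + sin (K^-1 * x)) / 2).
have [bp hp] : fourier_cvg p by exact: fourier_cvg_bernstein.
have close mu : controlled e2 M K mu ->
    `|\int[mu]_x (f x * k x) - \int[mu]_x (p x * k x)| <= eps.
  move=> [mK mM]; rewrite -bc_RintegralB; [|exact: bcM..].
  apply: (@le_trans _ _ (e1 * C * mass mu + 2 * B * C * tail_mass mu K)).
    apply: bc_norm_Rintegral_tail_le.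
    - by apply: bcB; exact: bcM.
    - by rewrite mulr_ge0 // ltW.
    - by rewrite !mulr_ge0.
    - by move=> x xK; rewrite -mulrBl normrM ler_pM //; exact: pe.
    - move=> x; rewrite -mulrBl normrM ler_pM //.
      apply: le_trans (ler_normB _ _) _.
      by have := fB x; have := pB x; rewrite -/(p x); lra.
  have h1 : e1 * C * mass mu <= eps / 2.
    apply: (@le_trans _ _ (e1 * (C * M + 1))); last by rewrite divfK ?gt_eqF.
    rewrite -mulrA ler_wpM2l ?(ltW e1p) //.
    have : C * mass mu <= C * M by rewrite ler_wpM2l.
    lra.
  have h2 : 2 * B * C * tail_mass mu K <= eps / 2.
    apply: (@le_trans _ _ ((2 * B * C + 1) * e2)); last by rewrite mulrC divfK ?gt_eqF.
    by rewrite ler_pM ?mulr_ge0 ?tail_mass_ge0 // lerDl.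
  lra.
exists (fun n => \int[nu_ n]_x (p x * k x)), (\int[nu]_x (p x * k x)); split.
- have [h _] := hp 0.
  have E mu : \int[mu]_x (cos (0 * x) * (p x * k x)) = \int[mu]_x (p x * k x).
    by congr Rintegral; apply/funext => x; rewrite mul0r cos0 mul1r.
  by move: h; rewrite E; under eq_fun do rewrite E.
- by apply: filterS nK => n; exact: close.
- exact: close.
Qed.

End weighted.

(** Removing the weight.  With [w = 1 / K] the weight is bounded below on
    [[-K, K]], where [f] is therefore the product of [damp_kernel w] and a bounded
    continuous [g].  Outside, [g] is continued by its values at the end points,
    where [damp_kernel w] is at least [1 / 8]: so [g * damp_kernel w] is bounded
    independently of [K], although [g] itself is not. *)
Lemma weak_cvg_of_weighted (nu_ : nat -> finite_borel_measure R) nu (h : R) :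
  0 < h -> tight nu_ nu ->
  (forall w, 0 < w <= h -> fourier_cvg nu_ nu (damp_kernel w) (fun=> 1)) ->
  forall f, bounded_continuous f ->
    \int[nu_ n]_x f x @[n --> \oo] --> \int[nu]_x f x.
Proof.
move=> h0 tg hw f bf; have [cf [B fB]] := bf.
have [M tM] := tg.
have B0 : 0 <= B by apply: le_trans (fB 0).
apply: cvg_approx => eps e0.
set e1 := eps / (21 * B + 1).
have B1 : 0 < 21 * B + 1 by rewrite ltr_wpDl // mulr_ge0.
have e1p : 0 < e1 by rewrite divr_gt0.
have [K1 K10 [hK1 nK1]] := tM _ e1p.
pose K := Num.max K1 (Num.max 1 h^-1).
have KK1 : K1 <= K by rewrite /K le_max lexx.
have K_ge1 : 1 <= K by rewrite /K !le_max lexx orbT.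
have Kh : h^-1 <= K by rewrite /K !le_max lexx !orbT.
have K0 : 0 < K by apply: lt_le_trans K_ge1.
pose w := K^-1; have w0 : 0 < w by rewrite invr_gt0.
have wh : w <= h by rewrite -[h]invrK lef_pV2 ?posrE ?invr_gt0.
have w1 : w <= 1 by rewrite invf_le1.
have lower x : w ^+ 2 / 8 <= damp_kernel w (clamp K x).
  apply: damp_kernel_lower; rewrite normrM (gtr0_norm w0) mulrC ler_pdivrMr //.
  by apply: le_trans (clamp_le _ (ltW K0)) _; lra.
have w8 : 0 < w ^+ 2 / 8 by rewrite divr_gt0 // exprn_gt0.
have kpos x : 0 < damp_kernel w (clamp K x) by apply: lt_le_trans (lower x).
pose g x := f (clamp K x) / damp_kernel w (clamp K x).
have bg : bounded_continuous g.
  split.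
    move=> x; apply: cvgM.
      by apply: (@continuous_comp _ _ _ (clamp K) f);
        [exact: continuous_clamp|exact: cf].
    apply: cvgV; first by rewrite gt_eqF.
    by apply: (@continuous_comp _ _ _ (clamp K) (damp_kernel w));
      [exact: continuous_clamp|exact: continuous_damp_kernel].
  exists (B / (w ^+ 2 / 8)) => x.
  rewrite normrM normfV (gtr0_norm (kpos x)) ler_pM ?invr_ge0 ?(ltW (kpos x)) //.
  by rewrite lef_pV2 ?posrE.
have close mu : controlled e1 M K1 mu ->
    `|\int[mu]_x f x - \int[mu]_x (g x * damp_kernel w x)| <= eps.
  move=> [mK mM]; have bk := bc_damp_kernel w.
  rewrite -bc_RintegralB //; last exact: bcM.
  apply: (@le_trans _ _ (0 * mass mu + 21 * B * tail_mass mu K)).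
    apply: bc_norm_Rintegral_tail_le => //.
    - by apply: bcB => //; exact: bcM.
    - by rewrite mulr_ge0.
    - move=> x xK; rewrite /g clamp_id // divfK ?subrr ?normr0 //.
      by have := kpos x; rewrite clamp_id // => /gt_eqF ->.
    - move=> x; have [xK|xK] := leP `|x| K.
        rewrite /g clamp_id // divfK ?subrr ?normr0 ?mulr_ge0 //.
        by have := kpos x; rewrite clamp_id // => /gt_eqF ->.
      have k8 : 8^-1 <= damp_kernel w (clamp K x).
        apply: le_trans (one_sub_cos_le_damp_kernel _ _).
        have n1 : `|w * clamp K x| = 1.
          by rewrite normrM (gtr0_norm w0) clamp_far ?(ltW K0) // mulVf // gt_eqF.
        have := @one_sub_cos_ge R (w * clamp K x).
        by rewrite -real_normK ?num_real // n1 expr1n mul1r; apply; rewrite ler1n.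
      have gB : `|g x| <= 8 * B.
        rewrite normrM normfV (gtr0_norm (kpos x)) mulrC ler_pM ?invr_ge0 ?(ltW (kpos x)) //.
        by rewrite -[8]invrK lef_pV2 ?posrE ?invr_gt0.
      have kB : `|damp_kernel w x| <= 5 / 2.
        rewrite ger0_norm ?damp_kernel_ge0 //; apply: le_trans (damp_kernel_le w x) _.
        have : w ^+ 2 <= 1 by rewrite exprn_ile1 // ltW.
        lra.
      have gk : `|g x * damp_kernel w x| <= (8 * B) * (5 / 2) by rewrite normrM ler_pM.
      apply: le_trans (ler_normB _ _) _; have := fB x; lra.
  rewrite mul0r add0r.
  apply: (@le_trans _ _ ((21 * B + 1) * e1)); last by rewrite mulrC divfK ?gt_eqF.
  rewrite ler_pM ?mulr_ge0 ?tail_mass_ge0 ?lerDl //.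
  by apply: le_trans mK; exact: tail_mass_anti.
exists (fun n => \int[nu_ n]_x (g x * damp_kernel w x)), (\int[nu]_x (g x * damp_kernel w x)); split.
- apply: levy_continuity => //; first exact: bc_damp_kernel.
  by apply: hw; rewrite w0.
- by apply: filterS nK1 => n; exact: close.
- exact: close.
Qed.

End weak_convergence.

(** * Modulus and phase of an infinitely divisible characteristic function *)

Section levy_transform.
Context {R : realType}.
Implicit Types (nu : finite_borel_measure R) (b u v w h eps eta p q : R).
Local Notation mu := (@lebesgue_measure R).

Definition phase b nu u : R := u * b + jump_phase nu u.
Definition cf_re b nu u : R := expR (- damping nu u) * cos (phase b nu u).
Definition cf_im b nu u : R := expR (- damping nu u) * sin (phase b nu u).

Lemma levy_cfE b nu u : levy_cf b nu u = (cf_re b nu u +i* cf_im b nu u)%C.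
Proof.
rewrite /levy_cf /levy_exponent /cintegral.
have -> : \int[nu]_x complex.Re (levy_kernel u x) = - damping nu u.
  rewrite -mulN1r -bc_RintegralZ; last exact: bc_damp_kernel.
  by congr Rintegral; apply/funext => x; rewrite levy_kernelE mulN1r.
have -> : \int[nu]_x complex.Im (levy_kernel u x) = jump_phase nu u.
  by congr Rintegral; apply/funext => x; rewrite levy_kernelE.
by rewrite /cexp /cis /cf_re /cf_im /phase /=; simpc.
Qed.

Lemma continuous_phase b nu : continuous (phase b nu).
Proof. by move=> u; apply: cvgD; [exact: continuous_mulr|exact: continuous_jump_phase]. Qed.

Lemma continuous_expN_damping nu : continuous (fun u => expR (- damping nu u)).
Proof.
move=> u; apply: (@continuous_comp _ _ _ (fun u => - damping nu u) (@expR R)).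
  by apply: cvgN; exact: continuous_damping.
exact: continuous_expR.
Qed.

Lemma continuous_cf_re b nu : continuous (cf_re b nu).
Proof.
move=> u; apply: cvgM; first exact: continuous_expN_damping.
by apply: (@continuous_comp _ _ _ (phase b nu) (@cos R));
  [exact: continuous_phase|exact: continuous_cos].
Qed.

Lemma continuous_cf_im b nu : continuous (cf_im b nu).
Proof.
move=> u; apply: cvgM; first exact: continuous_expN_damping.
by apply: (@continuous_comp _ _ _ (phase b nu) (@sin R));
  [exact: continuous_phase|exact: continuous_sin].
Qed.

Lemma damping0 nu : damping nu 0 = 0.
Proof.
rewrite /damping (_ : (fun x => damp_kernel 0 x) = fun=> 0);
  first by rewrite Rintegral_cst_mass mul0r.
by apply/funext => x; rewrite /damp_kernel mul0r cos0 subrr expr0n /= mul0r addr0.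
Qed.

Lemma cf_re0 b nu : cf_re b nu 0 = 1.
Proof.
rewrite /cf_re damping0 oppr0 expR0 mul1r /phase mul0r add0r /jump_phase.
rewrite (_ : (fun x => phase_kernel 0 x) = fun=> 0);
  first by rewrite Rintegral_cst_mass mul0r cos0.
by apply/funext => x; rewrite /phase_kernel mul0r sin0 expr0n /= mul0r addr0.
Qed.

Lemma expN_damping_le1 nu u : expR (- damping nu u) <= 1.
Proof. by rewrite -expR0 ler_expR oppr_le0 damping_ge0. Qed.

Lemma cf_re_le nu b u : cf_re b nu u <= expR (- damping nu u).
Proof. by rewrite ler_piMr ?expR_ge0 ?cos_le1. Qed.

Lemma cf_re_norm b nu u : `|cf_re b nu u| <= 1.
Proof.
rewrite normrM (ger0_norm (expR_ge0 _)) mulr_ile1 ?expR_ge0 ?expN_damping_le1 //.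
exact: cos_max.
Qed.

Lemma cf_im_norm b nu u : `|cf_im b nu u| <= 1.
Proof.
rewrite normrM (ger0_norm (expR_ge0 _)) mulr_ile1 ?expR_ge0 ?expN_damping_le1 //.
exact: sin_max.
Qed.

(** If [p = exp (- g w)] and [q = exp (- g (u + w))] then the chord inequality for
    [g] gives [1 - exp (- g u) <= 1 - p ^ 2 q ^ 2], at most
    [(1 - p ^ 2) + (1 - q ^ 2)]. *)
Lemma expN_damping_chord nu u w :
  1 - expR (- damping nu u) <=
  2 * (1 - expR (- damping nu w)) + 2 * (1 - expR (- damping nu (u + w))).
Proof.
have h : expR (- damping nu w) ^+ 2 * expR (- damping nu (u + w)) ^+ 2 <=
  expR (- damping nu u).
  have e2 (x : R) : expR x ^+ 2 = expR (2 * x) by rewrite expRM_natl.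
  rewrite !e2 -expRD ler_expR.
  by have := damping_chord nu u w; lra.
have p0 := expR_ge0 (- damping nu w); have p1 := expN_damping_le1 nu w.
have q0 := expR_ge0 (- damping nu (u + w)); have q1 := expN_damping_le1 nu (u + w).
move: h p0 p1 q0 q1.
move: (expR (- damping nu w)) (expR (- damping nu (u + w))) (expR (- damping nu u)) =>
  p q r.
move=> h p0 p1 q0 q1.
have : 0 <= (1 - p ^+ 2) * (1 - q ^+ 2) by rewrite mulr_ge0 // subr_ge0 exprn_ile1.
have : 0 <= (1 - p) ^+ 2 by rewrite sqr_ge0.
have : 0 <= (1 - q) ^+ 2 by rewrite sqr_ge0.
rewrite !expr2 in h *; lra.
Qed.

(** Averaging over [0 <= w <= h] turns the chord inequality into a bound of a
    single value by a mean. *)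
Lemma average_chord (f : R -> R) h u : continuous f -> (forall v, 0 <= f v) ->
  (forall w, f u <= 2 * f w + 2 * f (u + w)) -> 0 < h -> 0 <= u <= h ->
  h * f u <= 4 * \int[mu]_(v in `[0, 2 * h]) f v.
Proof.
move=> cf f0 chord h0 /andP[u0 uh].
have cfu : continuous (fun w => f (u + w)).
  move=> w; apply: (@continuous_comp _ _ _ (fun w => u + w) f); last exact: cf.
  by apply: cvgD; [exact: cst_continuous|exact: cvg_id].
have c2 (g : R -> R) : continuous g -> continuous (fun w => 2 * g w).
  by move=> cg w; apply: cvgM; [exact: cst_continuous|exact: cg].
have : \int[mu]_(w in `[0, h]) f u <= \int[mu]_(w in `[0, h]) (2 * f w + 2 * f (u + w)).
  have cs : continuous (fun w => 2 * f w + 2 * f (u + w)).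
    by move=> w; apply: cvgD; [exact: (c2 _ cf)|exact: (c2 _ cfu)].
  by apply: (itv_int_le (@cst_continuous _ _ _) cs) => w _; exact: chord.
rewrite itv_int_cst ?(ltW h0) // subr0 (itv_intD _ _ (c2 _ cf) (c2 _ cfu)).
rewrite !itv_intZ // itv_int_shift ?(ltW h0) //.
have : \int[mu]_(w in `[0, h]) f w <= \int[mu]_(w in `[0, 2 * h]) f w.
  by apply: itv_int_widen => //; lra.
have : \int[mu]_(w in `[u, u + h]) f w <= \int[mu]_(w in `[0, 2 * h]) f w.
  by apply: itv_int_widen => //; lra.
lra.
Qed.

Lemma expN_damping_average b nu h u : 0 < h -> 0 <= u <= h ->
  h * (1 - expR (- damping nu u)) <= 4 * (2 * h - \int[mu]_(v in `[0, 2 * h]) cf_re b nu v).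
Proof.
move=> h0 uh; have h20 : 0 <= 2 * h by rewrite mulr_ge0 // ltW.
have cf : continuous (fun v => 1 - expR (- damping nu v)).
  by move=> v; apply: cvgB; [exact: cst_continuous|exact: continuous_expN_damping].
have c1 : continuous (fun v => 1 - cf_re b nu v).
  by move=> v; apply: cvgB; [exact: cst_continuous|exact: continuous_cf_re].
have f0 v : 0 <= 1 - expR (- damping nu v) by rewrite subr_ge0 expN_damping_le1.
apply: le_trans (average_chord cf f0 (expN_damping_chord nu u) h0 uh) _.
rewrite ler_wpM2l //.
apply: (@le_trans _ _ (\int[mu]_(v in `[0, 2 * h]) (1 - cf_re b nu v))).
  by apply: (itv_int_le cf c1) => v _; rewrite lerD2l lerN2 cf_re_le.
rewrite itv_intB; [|exact: cst_continuous|exact: continuous_cf_re].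
by rewrite itv_int_cst // mul1r subr0.
Qed.

Lemma expN_lipschitz p q : 0 <= p -> 0 <= q -> `|expR (- p) - expR (- q)| <= `|p - q|.
Proof.
wlog pq : p q / p <= q => [hwlog p0 q0|p0 q0].
  have [/hwlog|/ltW qp] := leP p q; first exact.
  by rewrite distrC [leRHS]distrC; exact: hwlog.
rewrite ger0_norm ?subr_ge0 ?ler_expR ?lerN2 // distrC ger0_norm ?subr_ge0 //.
have -> : - q = - p + (p - q) by lra.
rewrite expRD -{1}[expR (- p)]mulr1 -mulrBr.
have h1 : 1 - expR (p - q) <= q - p by have := expR_ge1Dx (p - q); lra.
have h2 : expR (- p) <= 1 by rewrite -expR0 ler_expR; lra.
apply: le_trans h1; rewrite ler_piMl // subr_ge0 -[leRHS]expR0 ler_expR; lra.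
Qed.

Lemma cos_lipschitz p q : `|cos p - cos q| <= `|p - q|.
Proof.
have -> : cos p - cos q = - 2 * (sin ((p + q) / 2) * sin ((p - q) / 2)).
  have -> : cos p = cos ((p + q) / 2 + (p - q) / 2) by congr cos; lra.
  have -> : cos q = cos ((p + q) / 2 - (p - q) / 2) by congr cos; lra.
  by rewrite [X in _ - X]cosB cosD; ring.
rewrite normrM normrN (gtr0_norm (ltr0n R 2)) normrM.
have := sin_max ((p + q) / 2); have := ler_norm_sin ((p - q) / 2).
rewrite [`|(p - q) / 2|]normrM normfV (gtr0_norm (ltr0n R 2)).
move: (normr_ge0 (sin ((p + q) / 2))) (normr_ge0 (sin ((p - q) / 2))).
move: (`|sin ((p + q) / 2)|) (`|sin ((p - q) / 2)|) (`|p - q|) => a c d; nra.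
Qed.

Lemma sin_lipschitz p q : `|sin p - sin q| <= `|p - q|.
Proof.
rewrite -(cosBpihalf p) -(cosBpihalf q); apply: le_trans (cos_lipschitz _ _) _.
by rewrite opprB addrA subrK.
Qed.

Lemma polar_lipschitz (trig : R -> R) p q (a c : R) :
  (forall x, `|trig x| <= 1) -> (forall x y, `|trig x - trig y| <= `|x - y|) ->
  0 <= p -> 0 <= q ->
  `|expR (- p) * trig a - expR (- q) * trig c| <= `|p - q| + `|a - c|.
Proof.
move=> t1 tl p0 q0.
have -> : expR (- p) * trig a - expR (- q) * trig c =
  (expR (- p) - expR (- q)) * trig a + expR (- q) * (trig a - trig c) by ring.
apply: le_trans (ler_normD _ _) _; rewrite !normrM; apply: lerD.
  rewrite -[leRHS]mulr1 ler_pM //; exact: expN_lipschitz.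
rewrite -[leRHS]mul1r ler_pM // ger0_norm ?expR_ge0 //.
by rewrite -expR0 ler_expR oppr_le0.
Qed.

Lemma polar_mul_re p q (a c : R) :
  expR (- p) * cos a * (expR (- q) * cos c) - expR (- p) * sin a * (expR (- q) * sin c) =
  expR (- (p + q)) * cos (a + c).
Proof. by rewrite opprD expRD cosD; ring. Qed.

Lemma polar_mul_im p q (a c : R) :
  expR (- p) * cos a * (expR (- q) * sin c) + expR (- p) * sin a * (expR (- q) * cos c) =
  expR (- (p + q)) * sin (a + c).
Proof. by rewrite opprD expRD sinD; ring. Qed.

(** Near multiplicativity of the characteristic function, averaged: with the
    integrals [IA + i IB] of [phi] over [[0, h]], the integral of [phi] over
    [[u, u + h]] is close to [phi u * (IA + i IB)].  Real and imaginary parts are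
    treated separately. *)
Section near_multiplicative.
Variables (b : R) (nu : finite_borel_measure R) (eta u h G kap : R).
Hypotheses (eta0 : 0 < eta) (h0 : 0 < h).
Hypothesis gu : damping nu u <= G.
Hypothesis gw : forall w, 0 <= w <= h -> damping nu w <= kap.

Let e := 2 * (eta * G + kap / eta).

Let defect w : 0 <= w <= h ->
  `|damping nu (u + w) - (damping nu u + damping nu w)| +
  `|phase b nu (u + w) - (phase b nu u + phase b nu w)| <= 2 * e.
Proof.
move=> hw; have -> : phase b nu (u + w) - (phase b nu u + phase b nu w) =
    jump_phase nu (u + w) - jump_phase nu u - jump_phase nu w by rewrite /phase; ring.
have := damping_defect nu u w eta0; have := jump_phase_defect nu u w eta0.
rewrite opprD addrA.
have : eta * damping nu u <= eta * G by rewrite ler_wpM2l // ltW.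
have : damping nu w / eta <= kap / eta by rewrite ler_wpM2r ?gw // invr_ge0 ltW.
rewrite /e; lra.
Qed.

Local Notation A := (cf_re b nu).
Local Notation B := (cf_im b nu).
Local Notation IA := (\int[mu]_(w in `[0, h]) A w).
Local Notation IB := (\int[mu]_(w in `[0, h]) B w).

Let continuous_defect (c1 c2 : R) (f f1 f2 : R -> R) :
  continuous f -> continuous f1 -> continuous f2 ->
  continuous (fun w => f (u + w) - (c1 * f1 w + c2 * f2 w)).
Proof.
move=> cf cf1 cf2 w; apply: cvgB.
  apply: (@continuous_comp _ _ _ (fun w => u + w) f); last exact: cf.
  by apply: cvgD; [exact: cst_continuous|exact: cvg_id].
by apply: cvgD; apply: cvgM; [exact: cst_continuous|exact: cf1|
  exact: cst_continuous|exact: cf2].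
Qed.

Lemma cf_re_average :
  `|\int[mu]_(v in `[u, u + h]) A v - (A u * IA + - B u * IB)| <= 2 * e * h.
Proof.
have cA := @continuous_cf_re b nu; have cB := @continuous_cf_im b nu.
rewrite (itv_int_shift_lin _ _ _ (ltW h0) cA cA cB).
have -> : 2 * e * h = 2 * e * (h - 0) by rewrite subr0.
apply: (itv_int_norm_le (ltW h0) (continuous_defect cA cA cB)) => w hw.
apply: le_trans (defect hw); rewrite mulNr polar_mul_re.
apply: polar_lipschitz; rewrite ?addr_ge0 ?damping_ge0 //.
  exact: cos_max.
exact: cos_lipschitz.
Qed.

Lemma cf_im_average :
  `|\int[mu]_(v in `[u, u + h]) B v - (A u * IB + B u * IA)| <= 2 * e * h.
Proof.
have cA := @continuous_cf_re b nu; have cB := @continuous_cf_im b nu.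
rewrite (itv_int_shift_lin _ _ _ (ltW h0) cB cB cA).
have -> : 2 * e * h = 2 * e * (h - 0) by rewrite subr0.
apply: (itv_int_norm_le (ltW h0) (continuous_defect cB cB cA)) => w hw.
apply: le_trans (defect hw); rewrite polar_mul_im.
apply: polar_lipschitz; rewrite ?addr_ge0 ?damping_ge0 //.
  exact: sin_max.
exact: sin_lipschitz.
Qed.

End near_multiplicative.

End levy_transform.

(** * Null sequences of phases *)

Section null_sequences.
Context {R : realType}.
Implicit Types (x y delta c : nat -> R) (r eps a b h d u v : R).

Lemma cvg0_of_sqr x y : (\forall n \near \oo, x n ^+ 2 <= y n) ->
  y n @[n --> \oo] --> (0 : R) -> x n @[n --> \oo] --> (0 : R).
Proof.
move=> xy /cvgrPdist_le y0; apply/cvgrPdist_le => e e0.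
have := y0 (e ^+ 2) (exprn_gt0 _ e0); apply: filterS2 xy => n xyn.
rewrite !sub0r !normrN => yn.
have : `|x n| ^+ 2 <= e ^+ 2.
  rewrite real_normK ?num_real //; apply: le_trans xyn _.
  by apply: le_trans yn; exact: ler_norm.
by rewrite ler_sqr ?nnegrE ?normr_ge0 // ltW.
Qed.

(** The phase [delta n] tends to [0] modulo [2 pi]. *)
Definition phase_null delta := cos (delta n) @[n --> \oo] --> (1 : R).

Lemma eq_phase_null delta delta' : delta =1 delta' ->
  phase_null delta -> phase_null delta'.
Proof. by move=> /funext ->. Qed.

Lemma phase_null_sin delta : phase_null delta -> sin (delta n) @[n --> \oo] --> (0 : R).
Proof.
move=> pd; apply: (@cvg0_of_sqr _ (fun n => 2 * (1 - cos (delta n)))).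
  by apply: nearW => n; exact: sqr_sin_le.
have -> : (0 : R) = 2 * (1 - 1) by ring.
by apply: cvgMr; apply: cvgB => //; exact: cvg_cst.
Qed.

Lemma phase_nullD delta delta' : phase_null delta -> phase_null delta' ->
  phase_null (fun n => delta n + delta' n).
Proof.
move=> pd pd'; rewrite /phase_null; under eq_fun do rewrite cosD.
have -> : (1 : R) = 1 * 1 - 0 * 0 by ring.
by apply: cvgB; apply: cvgM => //; exact: phase_null_sin.
Qed.

Lemma phase_nullN delta : phase_null delta -> phase_null (fun n => - delta n).
Proof. by rewrite /phase_null => pd; under eq_fun do rewrite cosN. Qed.

Lemma phase_null_cvg0 delta : delta n @[n --> \oo] --> (0 : R) -> phase_null delta.
Proof.
by move=> d0; rewrite /phase_null -cos0; apply: continuous_cvg => //;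
  exact: continuous_cos.
Qed.

(** The cosine separates [0] from the other points of [[-2, 2]]. *)
Lemma phase_null_small delta : (\forall n \near \oo, `|delta n| <= 2) ->
  phase_null delta -> delta n @[n --> \oo] --> (0 : R).
Proof.
move=> d2 pd; apply: (@cvg0_of_sqr _ (fun n => 8 * (1 - cos (delta n)))).
  by apply: filterS d2 => n /one_sub_cos_ge; lra.
have -> : (0 : R) = 8 * (1 - 1) by ring.
by apply: cvgMr; apply: cvgB => //; exact: cvg_cst.
Qed.

(** If [u c_n] tends to [0] modulo [2 pi] for every [u] then [c_n] tends to [0]:
    by dominated convergence the means of [cos (u c_n)] over [[0, 1]] tend to
    [1], while they are at most one half when [|c_n| > 2]. *)
Lemma phase_null_drift c : (forall u, phase_null (fun n => u * c n)) ->
  c n @[n --> \oo] --> (0 : R).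
Proof.
move=> pc; apply: phase_null_small; last first.
  by have := pc 1; under eq_fun do rewrite mul1r.
have mD : measurable (`[0, 1]%classic : set (measurableTypeR R)) by [].
have cc n : continuous (fun u : R => cos (u * c n)) by exact: continuous_cos_mulr.
pose mu := @lebesgue_measure R.
have h1 : {ae mu, forall u : measurableTypeR R, `[0, 1]%classic u ->
    (cos (u * c n))%:E @[n --> \oo] --> 1%E}.
  by apply: aeW => u _; apply: cvg_EFin; [exact: nearW|exact: pc].
have h2 : {ae mu, forall (u : measurableTypeR R) n, `[0, 1]%classic u ->
    (`|(cos (u * c n))%:E| <= 1)%E}.
  by apply: aeW => u n _; rewrite lee_fin cos_max.
have h3 : mu.-integrable `[0, 1] (cst 1%E).
  exact: (itv_integrable 0 1 (@cst_continuous _ _ (1 : R))).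
have mf n : measurable_fun (`[0, 1]%classic : set (measurableTypeR R))
    (fun u => (cos (u * c n))%:E).
  exact: (measurable_int mu (itv_integrable 0 1 (cc n))).
have [_ _ dc] := dominated_convergence mD mf (measurable_cst _) h1 h3 h2.
have {}dc : \int[@lebesgue_measure R]_(u in `[0, 1]) cos (u * c n) @[n --> \oo] --> (1 : R).
  have e1 : (\int[@lebesgue_measure R]_(u in `[0%R, 1%R]) cst 1 u = 1%:E)%E.
    by rewrite integral_cst //= lebesgue_measure_itv /= lte_fin ltr01 mul1e sube0.
  rewrite e1 in dc; exact: fine_cvg dc.
move/cvgrPdist_lt : dc => /(_ 2^-1); rewrite invr_gt0 ltr0n => /(_ isT).
apply: filterS => n; rewrite ltr_norml => /andP[_ hn].
rewrite leNgt; apply/negP => cn2; have := @mean_one_sub_cos R 1 (c n) ltr01.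
rewrite divr1 => /(_ cn2); rewrite itv_intB; [|exact: cst_continuous|exact: cc].
by rewrite itv_int_cst // subr0 mulr1 => /le_lt_trans /(_ hn); rewrite div1r ltxx.
Qed.

(** A complex number [a + i b] of modulus at least [h / 2], seen as a rotation
    and dilation, scales [u + i v] by at least that factor. *)
Lemma rotation_bound a b h d u v : 0 < h -> 0 <= d ->
  h / 2 <= a -> `|a| <= h -> `|b| <= h ->
  `|a * u - b * v| <= d * h -> `|b * u + a * v| <= d * h ->
  `|u| <= 8 * d /\ `|v| <= 8 * d.
Proof.
move=> h0 d0 ha aH bH h1 h2.
have D : h ^+ 2 / 4 <= a ^+ 2 + b ^+ 2.
  by have := sqr_ge0 b; rewrite !expr2; nra.
have D0 : 0 < h ^+ 2 / 4 by rewrite divr_gt0 // exprn_gt0.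
have fin (w : R) : `|(a ^+ 2 + b ^+ 2) * w| <= h * (d * h) + h * (d * h) ->
    `|w| <= 8 * d.
  rewrite normrM [`|a ^+ 2 + b ^+ 2|]ger0_norm ?addr_ge0 ?sqr_ge0 // => k.
  have : h ^+ 2 / 4 * `|w| <= h ^+ 2 / 4 * (8 * d).
    apply: le_trans (ler_wpM2r _ D) (le_trans k _) => //.
    by rewrite expr2; lra.
  by rewrite ler_pM2l.
split; apply: fin.
- have -> : (a ^+ 2 + b ^+ 2) * u = a * (a * u - b * v) + b * (b * u + a * v) by ring.
  by apply: le_trans (ler_normD _ _) _; rewrite !normrM lerD // ler_pM.
- have -> : (a ^+ 2 + b ^+ 2) * v = a * (b * u + a * v) - b * (a * u - b * v) by ring.
  by apply: le_trans (ler_normB _ _) _; rewrite !normrM lerD // ler_pM.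
Qed.

(** From [exp g >= 1 + g]; the threshold is [1 - 1 / (1 + eps)]. *)
Lemma expN_small g eps : 0 <= g -> 0 < eps ->
  1 - expR (- g) <= eps / (1 + eps) -> g <= eps.
Proof.
move=> g0 e0 h; have h1 : (1 + g) * expR (- g) <= 1.
  rewrite -[leRHS](expRxMexpNx_1 g) ler_wpM2r ?expR_ge0 //; exact: expR_ge1Dx.
have e1 : 0 < 1 + eps by rewrite addr_gt0.
have h2 : (1 + eps)^-1 <= expR (- g).
  have -> : (1 + eps)^-1 = 1 - eps / (1 + eps) by field; rewrite gt_eqF.
  lra.
have : (1 + g) * (1 + eps)^-1 <= 1.
  by apply: le_trans h1; rewrite ler_wpM2l // addr_ge0.
by rewrite ler_pdivrMr // mul1r lerD2l.
Qed.

End null_sequences.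

(** * From integrated characteristic functions to their parameters *)

Section transform_convergence.
Context {R : realType}.
Implicit Types (eps u v w h s t K M : R).
Local Notation mu := (@lebesgue_measure R).

Variables (b_ : nat -> R) (nu_ : nat -> finite_borel_measure R).
Variables (b : R) (nu : finite_borel_measure R).

Hypothesis cvg_int_re : forall s t, s <= t ->
  \int[mu]_(v in `[s, t]) cf_re (b_ n) (nu_ n) v @[n --> \oo] -->
  \int[mu]_(v in `[s, t]) cf_re b nu v.
Hypothesis cvg_int_im : forall s t, s <= t ->
  \int[mu]_(v in `[s, t]) cf_im (b_ n) (nu_ n) v @[n --> \oo] -->
  \int[mu]_(v in `[s, t]) cf_im b nu v.

Lemma cf_re_near0 eps : 0 < eps -> exists2 h, 0 < h &
  forall v, 0 <= v <= h -> 1 - eps <= cf_re b nu v.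
Proof.
move=> e0; have /cvgrPdist_lt /(_ _ e0) /nbhs_ballP[r /= r0 hr] := @continuous_cf_re R b nu 0.
exists (r / 2); first by rewrite divr_gt0.
move=> v hv; have : `|cf_re b nu 0 - cf_re b nu v| < eps.
  by apply: hr; rewrite /ball /= sub0r normrN ger0_norm; lra.
by rewrite cf_re0 ltr_norml => /andP[_]; lra.
Qed.

Lemma damping_near0 eps : 0 < eps -> exists2 h, 0 < h &
  forall v, 0 <= v <= h -> damping nu v <= eps.
Proof.
move=> e0; have /cvgrPdist_lt /(_ _ e0) /nbhs_ballP[r /= r0 hr] := @continuous_damping R nu 0.
exists (r / 2); first by rewrite divr_gt0.
move=> v hv; have : `|damping nu 0 - damping nu v| < eps.
  by apply: hr; rewrite /ball /= sub0r normrN ger0_norm; lra.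
by rewrite damping0 sub0r normrN => /(le_lt_trans (ler_norm _)) /ltW.
Qed.

(** The mean of [cf_re b nu] over [[0, 2 h]] is close to [1] for small [h] by
    continuity at [0].  Those of the [cf_re (b_ n) (nu_ n)] converge to it, and
    [expN_damping_average] turns means into uniform pointwise bounds. *)
Lemma damping_small eps : 0 < eps -> exists2 h, 0 < h &
  (forall v, 0 <= v <= h -> damping nu v <= eps) /\
  \forall n \near \oo, forall v, 0 <= v <= h -> damping (nu_ n) v <= eps.
Proof.
move=> e0; set e1 := eps / (1 + eps).
have e1p : 0 < e1 by rewrite divr_gt0 // addr_gt0.
have [|h1 h1p A1] := @cf_re_near0 (e1 / 16); first by rewrite divr_gt0.
have [h2 h2p G2] := damping_near0 e0.
set h := Num.min (h1 / 2) h2.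
have h0 : 0 < h by rewrite lt_min h2p divr_gt0.
have hh1 : 2 * h <= h1 by have : h <= h1 / 2 by [rewrite ge_min lexx]; lra.
have hh2 : h <= h2 by rewrite ge_min lexx orbT.
exists h => //; split; first by move=> v hv; apply: G2; lra.
have h20 : 0 <= 2 * h by rewrite mulr_ge0 // ltW.
have lowI : (1 - e1 / 16) * (2 * h) <= \int[mu]_(v in `[0, 2 * h]) cf_re b nu v.
  rewrite -[X in _ * X](subr0 (2 * h)) -itv_int_cst //.
  apply: (itv_int_le (@cst_continuous _ _ _) (@continuous_cf_re _ b nu)) => v hv.
  by apply: A1; lra.
have e8 : 0 < e1 / 8 * h by rewrite mulr_gt0 // divr_gt0.
have /cvgrPdist_le /(_ _ e8) := cvg_int_re h20; apply: filterS => n.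
rewrite ler_norml => /andP[_ hn] v hv.
apply: (expN_small (damping_ge0 _ _) e0); rewrite -/e1.
have := expN_damping_average (b_ n) (nu_ n) h0 hv.
move: hn lowI; set I := \int[mu]_(_ in _) _; set J := \int[mu]_(_ in _) _.
move=> hn lowI avg; rewrite -(ler_pM2l h0); apply: le_trans avg _.
lra.
Qed.

Lemma tight_of_cf : tight nu_ nu.
Proof.
have [h1 h10 [G1 N1]] := damping_small ltr01.
exists (2 * 1 + 8 * 1 / h1 ^+ 2) => eps e0.
have [|h h0 [G N]] := @damping_small (eps / 2); first by rewrite divr_gt0.
have e2 : 0 <= eps / 2 by rewrite divr_ge0 // ltW.
have c2 : eps = 2 * (eps / 2) by lra.
exists (2 / h); first by rewrite divr_gt0.
split; first by split; [rewrite c2; exact: tail_mass_le|exact: mass_le].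
apply: filterS2 N1 N => n g1 g; split; last exact: mass_le.
by rewrite c2; exact: tail_mass_le.
Qed.

(** Both [phi_n u * (IA_n + i IB_n)] and [phi u * (IA + i IB)] are within
    [8 eps h] of the respective integrals over [[u, u + h]]
    ([cf_re_average], [cf_im_average]).  These integrals converge, and so do the
    factors [IA_n + i IB_n], whose limit has real part at least [h / 2] and can be
    divided out. *)
Lemma cf_cvg u : cf_re (b_ n) (nu_ n) u @[n --> \oo] --> cf_re b nu u /\
  cf_im (b_ n) (nu_ n) u @[n --> \oo] --> cf_im b nu u.
Proof.
suff H eps : 0 < eps -> \forall n \near \oo,
    `|cf_re (b_ n) (nu_ n) u - cf_re b nu u| <= 152 * eps /\
    `|cf_im (b_ n) (nu_ n) u - cf_im b nu u| <= 152 * eps.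
  split; apply/cvgrPdist_le => e e0; have e1 : 0 < e / 152 by rewrite divr_gt0.
    by apply: filterS (H _ e1) => n [+ _]; rewrite distrC mulrC divfK.
  by apply: filterS (H _ e1) => n [_]; rewrite distrC mulrC divfK.
move=> e0; have [M tM] := tight_of_cf; have [K _ [[_ mM] nM]] := tM 1 ltr01.
have M0 : 0 <= M by apply: le_trans mM; exact: mass_ge0.
set G := (2 + u ^+ 2 / 2) * M.
have C0 : 0 <= 2 + u ^+ 2 / 2 by have := sqr_ge0 u; lra.
have G0 : 0 <= G by exact: mulr_ge0.
have gG nu' : mass nu' <= M -> damping nu' u <= G.
  move=> m; apply: (@le_trans _ _ ((2 + u ^+ 2 / 2) * mass nu')); last exact: ler_wpM2l.
  rewrite -Rintegral_cst_mass; apply: bc_le_Rintegral;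
    [exact: bc_damp_kernel|exact: bc_cst|].
  by move=> x; exact: damp_kernel_le.
(* [G] bounds the damping at [u]; this [eta] makes [eta * G] at most [eps]. *)
set eta := eps / (G + 1); have eta0 : 0 < eta by rewrite divr_gt0 // ltr_wpDl.
have [|h1 h10 [G1 N1]] := @damping_small (eps * eta); first exact: mulr_gt0.
have [|h2 h20 A2] := @cf_re_near0 2^-1; first by rewrite invr_gt0.
set h := Num.min h1 h2.
have h0 : 0 < h by rewrite lt_min h10.
have hh1 : h <= h1 by rewrite ge_min lexx.
have hh2 : h <= h2 by rewrite ge_min lexx orbT.
have E : 2 * (2 * (eta * G + eps * eta / eta)) * h <= 8 * eps * h.
  rewrite ler_pM2r // mulfK ?gt_eqF //.
  have : eta * G <= eps; last by lra.
  rewrite /eta -mulrA ler_piMr ?(ltW e0) // mulrC ler_pdivrMr ?ltr_wpDl // mul1r.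
  by rewrite lerDl.
have sub (g : R -> R) (e : R) : (forall v, 0 <= v <= h1 -> g v <= e) ->
    forall v, 0 <= v <= h -> g v <= e.
  by move=> ge v hv; apply: ge; lra.
have re0 := le_trans (cf_re_average b eta0 h0 (gG _ mM) (sub _ _ G1)) E.
have im0 := le_trans (cf_im_average b eta0 h0 (gG _ mM) (sub _ _ G1)) E.
have uh : u <= u + h by rewrite lerDl ltW.
have eh : 0 < eps * h by exact: mulr_gt0.
have cA := @continuous_cf_re R; have cB := @continuous_cf_im R.
have aH : `|\int[mu]_(w in `[0, h]) cf_re b nu w| <= h.
  rewrite -[leRHS]mul1r -[X in _ * X](subr0 h).
  apply: (itv_int_norm_le (ltW h0) (cA b nu)) => v _; exact: cf_re_norm.
have bH : `|\int[mu]_(w in `[0, h]) cf_im b nu w| <= h.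
  rewrite -[leRHS]mul1r -[X in _ * X](subr0 h).
  apply: (itv_int_norm_le (ltW h0) (cB b nu)) => v _; exact: cf_im_norm.
have ha : h / 2 <= \int[mu]_(w in `[0, h]) cf_re b nu w.
  have -> : h / 2 = 2^-1 * (h - 0) by rewrite subr0 mulrC.
  rewrite -(itv_int_cst 2^-1 (ltW h0)).
  apply: (itv_int_le (@cst_continuous _ _ _) (cA b nu)) => v hv.
  have -> : 2^-1 = 1 - 2^-1 :> R by lra.
  by apply: A2; lra.
have /cvgrPdist_le /(_ _ eh) X1 := cvg_int_re uh.
have /cvgrPdist_le /(_ _ eh) X2 := cvg_int_im uh.
have /cvgrPdist_le /(_ _ eh) X3 := cvg_int_re (ltW h0).
have /cvgrPdist_le /(_ _ eh) X4 := cvg_int_im (ltW h0).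
apply: (filterS _ (filterI (filterI X1 X2) (filterI (filterI X3 X4) (filterI N1 nM)))).
move=> n [[{}X1 {}X2] [[{}X3 {}X4] [{}N1 [_ mMn]]]].
have ren := le_trans (cf_re_average (b_ n) eta0 h0 (gG _ mMn) (sub _ _ N1)) E.
have imn := le_trans (cf_im_average (b_ n) eta0 h0 (gG _ mMn) (sub _ _ N1)) E.
have An := cf_re_norm (b_ n) (nu_ n) u; have Bn := cf_im_norm (b_ n) (nu_ n) u.
move: aH bH ha re0 im0 ren imn X1 X2 X3 X4 An Bn.
rewrite !mulNr.
move: (\int[mu]_(w in `[0, h]) cf_re b nu w) (\int[mu]_(w in `[0, h]) cf_im b nu w).
move: (\int[mu]_(w in `[0, h]) cf_re (b_ n) (nu_ n) w).
move: (\int[mu]_(w in `[0, h]) cf_im (b_ n) (nu_ n) w).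
move: (\int[mu]_(w in `[u, u + h]) cf_re b nu w).
move: (\int[mu]_(w in `[u, u + h]) cf_im b nu w).
move: (\int[mu]_(w in `[u, u + h]) cf_re (b_ n) (nu_ n) w).
move: (\int[mu]_(w in `[u, u + h]) cf_im (b_ n) (nu_ n) w).
move: (cf_re (b_ n) (nu_ n) u) (cf_im (b_ n) (nu_ n) u) (cf_re b nu u) (cf_im b nu u).
move=> An Bn A B Yn Xn Y X cn an a c aH bH ha re0 im0 ren imn X1 X2 X3 X4 An1 Bn1.
have P1 : `|An * (an - a)| <= eps * h.
  by rewrite normrM -[leRHS]mul1r ler_pM // distrC.
have P2 : `|Bn * (cn - c)| <= eps * h.
  by rewrite normrM -[leRHS]mul1r ler_pM // distrC.
have P3 : `|An * (cn - c)| <= eps * h.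
  by rewrite normrM -[leRHS]mul1r ler_pM // distrC.
have P4 : `|Bn * (an - a)| <= eps * h.
  by rewrite normrM -[leRHS]mul1r ler_pM // distrC.
(* 19 = 8 + 8 from the two averages, 1 from their limits, 2 from the factors;
   [rotation_bound] multiplies it by 8. *)
have d0 : 0 <= 19 * eps by rewrite mulr_ge0 // ltW.
have [] := @rotation_bound R a c h (19 * eps) (An - A) (Bn - B) h0 d0 ha aH bH.
- have -> : a * (An - A) - c * (Bn - B) =
    - (Xn - (An * an - Bn * cn)) + (Xn - X) + (X - (A * a - B * c))
    - An * (an - a) + Bn * (cn - c) by ring.
  move: re0 ren X1 P1 P2; rewrite [`|X - Xn|]distrC !ler_norml.
  move: (Xn - (An * an - Bn * cn)) (Xn - X) (X - (A * a - B * c)) => q1 q2 q3.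
  move: (An * (an - a)) (Bn * (cn - c)) => q4 q5; lra.
- have -> : c * (An - A) + a * (Bn - B) =
    - (Yn - (An * cn + Bn * an)) + (Yn - Y) + (Y - (A * c + B * a))
    - An * (cn - c) - Bn * (an - a) by ring.
  move: im0 imn X2 P3 P4; rewrite [`|Y - Yn|]distrC !ler_norml.
  move: (Yn - (An * cn + Bn * an)) (Yn - Y) (Y - (A * c + B * a)) => q1 q2 q3.
  move: (An * (cn - c)) (Bn * (an - a)) => q4 q5; lra.
by move=> h3 h4; split; lra.
Qed.

Lemma cf_sqr_norm b' nu' u :
  cf_re b' nu' u ^+ 2 + cf_im b' nu' u ^+ 2 = expR (- damping nu' u) ^+ 2.
Proof. by rewrite /cf_re /cf_im !exprMn -mulrDr cos2Dsin2 mulr1. Qed.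

Lemma damping_cvg u : damping (nu_ n) u @[n --> \oo] --> damping nu u.
Proof.
have E b' nu' : damping nu' u = - (2^-1 * ln (cf_re b' nu' u * cf_re b' nu' u +
    cf_im b' nu' u * cf_im b' nu' u)).
  rewrite -!expr2 cf_sqr_norm lnXn ?expR_gt0 // expRK; lra.
rewrite (E b) (funext (fun n => E (b_ n) (nu_ n))).
have [cA cB] := cf_cvg u.
apply: cvgN; apply: cvgMr; apply: (@continuous_cvg _ _ _ _ _ _ (@ln R)).
  by apply: continuous_ln; rewrite -!expr2 cf_sqr_norm exprn_gt0 // expR_gt0.
by apply: cvgD; apply: cvgM.
Qed.

(** All that pointwise convergence says about the phases: dividing out the
    moduli, which converge to nonzero limits, leaves points of the circle. *)
Lemma phase_null_phase_diff u : phase_null (fun n => phase (b_ n) (nu_ n) u - phase b nu u).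
Proof.
have E n : cos (phase (b_ n) (nu_ n) u - phase b nu u) =
    (cf_re (b_ n) (nu_ n) u * cf_re b nu u + cf_im (b_ n) (nu_ n) u * cf_im b nu u) *
    (expR (damping (nu_ n) u) * expR (damping nu u)).
  rewrite cosB /cf_re /cf_im !expRN.
  by field; rewrite !gt_eqF ?expR_gt0.
rewrite /phase_null; under eq_fun do rewrite E.
have -> : (1 : R) = (cf_re b nu u * cf_re b nu u + cf_im b nu u * cf_im b nu u) *
    (expR (damping nu u) * expR (damping nu u)).
  by rewrite -!expr2 cf_sqr_norm -exprMn mulrC expRxMexpNx_1 expr1n.
have [cA cB] := cf_cvg u.
apply: cvgM; first by apply: cvgD; apply: cvgMl.
apply: cvgMl; apply: continuous_cvg; [exact: continuous_expR|exact: damping_cvg].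
Qed.

(** Second differences of the phases are real numbers of modulus at most [1],
    being dominated by [2 * damping _ w], so that for them convergence modulo
    [2 pi] is plain convergence. *)
Lemma jump_phase_second_diff_cvg u w :
  damping nu w <= 2^-1 -> (\forall n \near \oo, damping (nu_ n) w <= 2^-1) ->
  jump_phase (nu_ n) (u + w) + jump_phase (nu_ n) (u - w) - 2 * jump_phase (nu_ n) u
    @[n --> \oo] -->
  jump_phase nu (u + w) + jump_phase nu (u - w) - 2 * jump_phase nu u.
Proof.
move=> gw gwn; pose D nu' := jump_phase nu' (u + w) + jump_phase nu' (u - w)
  - 2 * jump_phase nu' u.
have small nu' : damping nu' w <= 2^-1 -> `|D nu'| <= 1.
  by move=> g; apply: le_trans (jump_phase_second_diff_le nu' u w) _; lra.
suff d0 : D (nu_ n) - D nu @[n --> \oo] --> (0 : R).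
  rewrite -/(D nu) -[D nu]add0r.
  under eq_fun do rewrite -/(D (nu_ _)) -[D (nu_ _)](subrK (D nu)).
  by apply: cvgD => //; exact: cvg_cst.
apply: phase_null_small.
  apply: filterS gwn => n gn; apply: le_trans (ler_normB _ _) _.
  by have := small _ gn; have := small _ gw; lra.
have p v := phase_null_phase_diff v.
apply: eq_phase_null (phase_nullD (phase_nullD (p (u + w)) (p (u - w)))
  (phase_nullN (phase_nullD (p u) (p u)))) => n.
by rewrite /D /phase; ring.
Qed.

Lemma weighted_fourier_cvg : exists2 h, 0 < h &
  forall w, 0 < w <= h -> fourier_cvg nu_ nu (damp_kernel w) (fun=> 1).
Proof.
have [|h h0 [g gn]] := @damping_small 2^-1; first by rewrite invr_gt0.
exists h => // w /andP[w0 wh]; split=> [|u]; first exact: bc_cst.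
have hw : 0 <= w <= h by rewrite ltW.
have Ec (nu' : finite_borel_measure R) : \int[nu']_x (cos (u * x) * (1 * damp_kernel w x)) =
    2^-1 * (damping nu' (u + w) + damping nu' (u - w) - 2 * damping nu' u).
  rewrite damping_second_diff mulKf //.
  by congr Rintegral; apply/funext => x; rewrite mul1r.
have Es (nu' : finite_borel_measure R) : \int[nu']_x (sin (u * x) * (1 * damp_kernel w x)) =
    - 2^-1 * (jump_phase nu' (u + w) + jump_phase nu' (u - w) - 2 * jump_phase nu' u).
  rewrite jump_phase_second_diff mulNr mulNr mulrN opprK mulKf //.
  by congr Rintegral; apply/funext => x; rewrite mul1r.
rewrite Ec Es; under eq_fun do rewrite Ec.
under [X in _ /\ (X @ _ --> _)]eq_fun do rewrite Es.
split; apply: cvgMr.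
  by apply: cvgB; [apply: cvgD|apply: cvgMr]; exact: damping_cvg.
by apply: jump_phase_second_diff_cvg; [exact: g|apply: filterS gn => n; exact].
Qed.

Lemma integral_cvg_of_cf f : bounded_continuous f ->
  \int[nu_ n]_x f x @[n --> \oo] --> \int[nu]_x f x.
Proof.
have [h h0 hw] := weighted_fourier_cvg.
exact: (weak_cvg_of_weighted h0 tight_of_cf hw).
Qed.

Lemma drift_cvg_of_cf : b_ n @[n --> \oo] --> b.
Proof.
suff d0 : b_ n - b @[n --> \oo] --> (0 : R).
  rewrite -[b]add0r; under eq_fun do rewrite -[b_ _](subrK b).
  by apply: cvgD => //; exact: cvg_cst.
apply: phase_null_drift => u.
have g0 : jump_phase nu u - jump_phase (nu_ n) u @[n --> \oo] --> (0 : R).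
  rewrite -(subrr (jump_phase nu u)); apply: cvgB; first exact: cvg_cst.
  exact/integral_cvg_of_cf/bc_phase_kernel.
apply: eq_phase_null (phase_nullD (phase_null_phase_diff u) (phase_null_cvg0 g0)) => n.
by rewrite /phase; ring.
Qed.

End transform_convergence.

(** * Consistency *)

Lemma complex_cvg_Re {R : realType} (z_ : nat -> R[i]) (z : R[i]) :
  (z_ n : R[i]^o) @[n --> \oo] --> (z : R[i]^o) ->
  complex.Re (z_ n) @[n --> \oo] --> complex.Re z.
Proof.
move=> /cvgrPdist_le h; apply/cvgrPdist_le => e e0.
have e0' : (0 : R[i]) < (e%:C)%C by rewrite ltcR.
apply: filterS (h _ e0') => n hn; rewrite -lecR.
by apply: le_trans hn; rewrite -raddfB; exact: normc_ge_Re.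
Qed.

Lemma complex_cvg_Im {R : realType} (z_ : nat -> R[i]) (z : R[i]) :
  (z_ n : R[i]^o) @[n --> \oo] --> (z : R[i]^o) ->
  complex.Im (z_ n) @[n --> \oo] --> complex.Im z.
Proof.
move=> /cvgrPdist_le h; apply/cvgrPdist_le => e e0.
have e0' : (0 : R[i]) < (e%:C)%C by rewrite ltcR.
apply: filterS (h _ e0') => n hn; rewrite -lecR.
apply: le_trans hn; rewrite -raddfB normc_def lecR -sqrtr_sqr.
by rewrite ler_wsqrtr // lerDr sqr_ge0.
Qed.

Lemma Re_cintegral_levy_cf {R : realType} (b : R) (nu : finite_borel_measure R) (s t : R) :
  s <= t -> complex.Re (cintegral_between s t (levy_cf b nu)) =
  \int[lebesgue_measure]_(v in `[s, t]) cf_re b nu v.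
Proof.
move=> st; rewrite /cintegral_between st.
transitivity (\int[lebesgue_measure]_(v in `[s, t]) complex.Re (levy_cf b nu v)) => //.
by apply: eq_Rintegral => v _; rewrite levy_cfE.
Qed.

Lemma Im_cintegral_levy_cf {R : realType} (b : R) (nu : finite_borel_measure R) (s t : R) :
  s <= t -> complex.Im (cintegral_between s t (levy_cf b nu)) =
  \int[lebesgue_measure]_(v in `[s, t]) cf_im b nu v.
Proof.
move=> st; rewrite /cintegral_between st.
transitivity (\int[lebesgue_measure]_(v in `[s, t]) complex.Im (levy_cf b nu v)) => //.
by apply: eq_Rintegral => v _; rewrite levy_cfE.
Qed.

Theorem levy_parameters_cvg {R : realType} (b_ : nat -> R)
    (nu_ : nat -> finite_borel_measure R) (b : R) (nu : finite_borel_measure R) :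
  (forall s t : R, (cintegral_between s t (levy_cf (b_ n) (nu_ n)) : R[i]^o) @[n --> \oo]
     --> (cintegral_between s t (levy_cf b nu) : R[i]^o)) ->
  (b_ n @[n --> \oo] --> b) /\ weak_cvg nu_ nu.
Proof.
move=> h.
have hre s t : s <= t ->
    \int[@lebesgue_measure R]_(v in `[s, t]) cf_re (b_ n) (nu_ n) v @[n --> \oo] -->
    \int[@lebesgue_measure R]_(v in `[s, t]) cf_re b nu v.
  move=> st; have := complex_cvg_Re (h s t); rewrite Re_cintegral_levy_cf //.
  by under eq_fun do rewrite Re_cintegral_levy_cf //.
have him s t : s <= t ->
    \int[@lebesgue_measure R]_(v in `[s, t]) cf_im (b_ n) (nu_ n) v @[n --> \oo] -->
    \int[@lebesgue_measure R]_(v in `[s, t]) cf_im b nu v.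
  move=> st; have := complex_cvg_Im (h s t); rewrite Im_cintegral_levy_cf //.
  by under eq_fun do rewrite Im_cintegral_levy_cf //.
split; first exact: drift_cvg_of_cf hre him.
move=> f cf bf; apply: (integral_cvg_of_cf hre him).
exact: bc_of_bounded.
Qed.

Theorem theorem3p1 (R : realType) (disp : measure_display)
  (Omega : measurableType disp) (P : probability Omega R)
  (b : R) (nu : finite_borel_measure R)
  (X : R -> {RV P >-> R}) (levyX : levy_process_with X b nu)
  (S : set (R -> R[i])) (d : (R -> R[i]) -> (R -> R[i]) -> R)
  (S_cf : forall (b' : R) (nu' : finite_borel_measure R), S (levy_cf b' nu'))
  (S_ecf : forall (n : nat) (w : Omega), (0 < n)%N -> S (empirical_cf X n w))
  (d_metric : metric_on S d)
  (d_ecf_cvg : {ae P, forall w,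
     d (empirical_cf X n w) (levy_cf b nu) @[n --> \oo] --> (0 : R)})
  (d_cvg_integral :
     forall (b_ : nat -> R) (nu_ : nat -> finite_borel_measure R),
       d (levy_cf (b_ n) (nu_ n)) (levy_cf b nu) @[n --> \oo] --> (0 : R) ->
       forall s t : R,
         (cintegral_between s t (levy_cf (b_ n) (nu_ n)) : R[i]^o) @[n --> \oo]
           --> (cintegral_between s t (levy_cf b nu) : R[i]^o))
  (delta : nat -> R) (delta_gt0 : forall n, 0 < delta n)
  (delta_cvg0 : delta n @[n --> \oo] --> (0 : R))
  (bhat : nat -> Omega -> R) (nuhat : nat -> Omega -> finite_borel_measure R)
  (min_dist_fit : forall (n : nat) (w : Omega), (0 < n)%N ->
     d (empirical_cf X n w) (levy_cf (bhat n w) (nuhat n w)) <=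
     inf [set d (empirical_cf X n w) (levy_cf p.1 p.2) |
            p in [set: R * finite_borel_measure R]] + delta n) :
  {ae P, forall w,
     (bhat n w @[n --> \oo] --> b) /\
     weak_cvg (fun n => nuhat n w) nu}.
Proof.
have [d_ge0 _ d_sym d_tri] := d_metric.
apply: filterS d_ecf_cvg => w ecf.
apply: levy_parameters_cvg; apply: d_cvg_integral.
have bound n : (0 < n)%N ->
    0 <= d (levy_cf (bhat n w) (nuhat n w)) (levy_cf b nu) <=
    2 * d (empirical_cf X n w) (levy_cf b nu) + delta n.
  move=> n0; have Sn := S_ecf n w n0.
  rewrite d_ge0 //=.
  apply: le_trans (d_tri _ _ _ (S_cf _ _) Sn (S_cf _ _)) _.
  rewrite d_sym //.
  have /= := min_dist_fit n w n0; set I := inf _ => fit.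
  have : I <= d (empirical_cf X n w) (levy_cf b nu).
    apply: ge_inf; last by exists (b, nu).
    by exists 0 => _ [p _ <-]; exact: d_ge0.
  lra.
apply: (@squeeze_cvgr _ _ _ _ (fun=> 0)
  (fun n => 2 * d (empirical_cf X n w) (levy_cf b nu) + delta n)).
- by exists 1%N => // n; exact: bound.
- exact: cvg_cst.
- have -> : (0 : R) = 2 * 0 + 0 by ring.
  by apply: cvgD => //; exact: cvgMr.
Qed.
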